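(* With $\alpha=(1+\sqrt5)/2$, $\beta=(1-\sqrt5)/2$: $$\sum_{k=1}^\infty\frac{L_k}{2^{k+2}(2k-1)k^2(2k+1)}=1-\frac{\pi^2}{48}+\frac14\ln^22-\frac12\ln^2\alpha-\frac{1}{2\alpha^2\sqrt{2\alpha}}\operatorname{arctanh}\Big(\sqrt{\tfrac\alpha2}\Big)-\frac{\alpha^2\sqrt\alpha}{2\sqrt2}\arctan\Big(\sqrt{\tfrac1{2\alpha}}\Big),$$ $$\sum_{k=1}^\infty\frac{L_{3k}}{5^k(2k-1)(2k)^2(2k+1)}=1-\frac{\pi^2}{48}+\frac12\ln^22-\frac32\ln^2\alpha-\frac12\ln2\ln5+\frac14\ln^25+\frac14\operatorname{Li}_2\Big(-\frac14\Big)$$ $$\qquad-\frac{1}{\alpha^3\sqrt{5\alpha}}\operatorname{arctanh}\Big(\frac{\alpha\sqrt\alpha}{\sqrt5}\Big)-\frac{\alpha^3\sqrt\alpha}{\sqrt5}\arctan\Big(\frac{1}{\alpha\sqrt{5\alpha}}\Big);$$ for every even integer $r\ge0$, $$\sum_{k=1}^\infty\frac{L_{rk}}{L_r^k(2k-1)(2k)^2(2k+1)}=1-\frac{\pi^2}{24}-\frac14r^2\ln^2\alpha+\frac14\ln^2(L_r)-\frac12\sqrt{\frac{1}{\alpha^{3r}L_r}}\operatorname{arctanh}\Big(\sqrt{\frac{\alpha^r}{L_r}}\Big)-\frac12\sqrt{\frac{\alpha^{3r}}{L_r}}\operatorname{arctanh}\Big(\sqrt{\frac{1}{\alpha^rL_r}}\Big);$$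 $$\sum_{k=1}^\infty\frac{L_{2k}}{5^k(4k-1)(4k)^2(4k+1)}+\sum_{k=1}^\infty\frac{F_{2k-1}}{5^{k-1}(4k-3)(4k-2)^2(4k-1)}=1-\frac{\pi^2}{24}+\frac1{16}\ln^25-\frac14\ln^2\alpha$$ $$\qquad-\frac{1}{2\sqrt{\sqrt5}}\left(\frac{1}{\alpha\sqrt\alpha}\operatorname{arctanh}\Big(\sqrt{\frac{\alpha}{\sqrt5}}\Big)+\alpha\sqrt\alpha\,\operatorname{arctanh}\Big(\sqrt{\frac{1}{\sqrt5\,\alpha}}\Big)\right);$$ and $$\sum_{k=1}^\infty\frac{L_{2k}}{4^{k+1}(2k-1)k^2(2k+1)}=1-\frac{\pi^2}{24}-\frac12\ln^2\alpha-\frac{9\sqrt5}{8}\ln\alpha+\frac5{16}\ln5+\frac18\ln^25-\frac12\ln2\ln5+\ln^22+\frac14\operatorname{Li}_2\Big(\frac15\Big).$$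
   Context: $F_n=(\alpha^n-\beta^n)/(\alpha-\beta)$ and $L_n=\alpha^n+\beta^n$ are the Fibonacci and Lucas numbers. $\operatorname{arctanh}(x)=\frac12\ln\frac{1+x}{1-x}$ for $|x|<1$; $\operatorname{Li}_2(x)=\sum_{k\ge1}x^k/k^2$ is the dilogarithm. *)

(* Defs.v *)
From Stdlib Require Import Reals.
From Coquelicot Require Import Coquelicot.
Open Scope R_scope.

Definition alpha : R := (1 + sqrt 5) / 2.
Definition beta : R := (1 - sqrt 5) / 2.

Definition Fib (n : nat) : R := (alpha ^ n - beta ^ n) / (alpha - beta).
Definition Luc (n : nat) : R := alpha ^ n + beta ^ n.

Definition arctanh (x : R) : R := / 2 * ln ((1 + x) / (1 - x)).

Definition Li2 (x : R) : R := Series (fun n : nat => x ^ (S n) / (INR (S n)) ^ 2).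

(* Main.v *)
(* Partial fractions give, for |z| < 1,
     sum_{k>=1} z^k / ((2k-1)(2k)^2(2k+1)) = 1/2 - (1-z) A(z)/2 - Li2(z)/4,   A(z) = sum_{n>=0} z^n/(2n+1),
   where t A(t^2) = arctanh t and t A(-t^2) = arctan t.  Each of the five sums is the value of this function at z = x plus its value at z = y, for a pair x, y built from alpha and beta, so what remains is to evaluate Li2(x) + Li2(y).  All evaluations come from Abel's five-term relation
     Li2(x/(1-y)) + Li2(y/(1-x)) - Li2(x) - Li2(y) - Li2(xy/((1-x)(1-y))) = ln(1-x) ln(1-y),
   extended by continuity to the boundary x + |y| = 1: with x + y = 1 it is Euler's reflection formula; at (alpha^-2, -alpha^-1) it gives Li2(alpha^-3) - Li2(-alpha^-3), hence with Landen's formula the pair (alpha/2, beta/2); at (alpha^3/5, beta^3/5) it reduces to that pair and Li2(-1/4); at (alpha^2/4, beta^2/4) it reduces to the reflection pair (alpha/sqrt 5, 1/(alpha sqrt 5)) and Li2(1/5).  The value Li2(1) = pi^2/6 is obtained from the finite sums of 1/sin^2 over dyadic angles. *)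
Require Import Defs.
From Stdlib Require Import Reals Lra Lia Psatz.
From Coquelicot Require Import Coquelicot.
Open Scope R_scope.

(** * Power series *)

(** Functional identities are propagated from 0 in this way: the difference of the two sides has
    derivative zero. The other endpoint may lie on either side of 0, hence [Rmin] and [Rmax]. *)
Lemma is_derive_0_eq (f : R -> R) (a b : R) :
  (forall t, Rmin a b <= t <= Rmax a b -> is_derive f t 0) -> f a = f b.
Proof.
  intros H.
  destruct (Rtotal_order a b) as [Hab | [-> | Hab]].
  - apply (eq_is_derive f a b); [| exact Hab].
    intros t Ht; apply H.
    rewrite Rmin_left, Rmax_right by lra; lra.
  - reflexivity.
  - symmetry; apply (eq_is_derive f b a); [| exact Hab].
    intros t Ht; apply H.
    rewrite Rmin_right, Rmax_left by lra; lra.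
Qed.

Lemma CV_radius_bounded_coef (a : nat -> R) (x : R) :
  (forall n, Rabs (a n) <= 1) -> Rabs x < 1 -> Rbar_lt (Rabs x) (CV_radius a).
Proof.
  intros Ha Hx.
  apply Rbar_lt_le_trans with (Finite 1); [exact Hx |].
  apply (CV_radius_bounded a).
  exists 1; intros n; rewrite pow1, Rmult_1_r; apply Ha.
Qed.

(** The case [x = 0], where [/ 0 = 0], covers the vanishing coefficients at index 0. *)
Lemma Rabs_inv_ge1 (x : R) : x = 0 \/ 1 <= x -> Rabs (/ x) <= 1.
Proof.
  intros [-> | Hx].
  - rewrite Rinv_0, Rabs_R0; lra.
  - rewrite Rabs_pos_eq by (left; apply Rinv_0_lt_compat; lra).
    rewrite <- Rinv_1; apply Rinv_le_contravar; lra.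
Qed.

Lemma INR_0_or_ge1 (n : nat) : INR n = 0 \/ 1 <= INR n.
Proof.
  destruct n as [| n]; [left; reflexivity | right].
  rewrite S_INR; pose proof (pos_INR n); lra.
Qed.

(* [/ 0 = 0], so [log_coef] and [dilog_coef] vanish at index [0]. *)
Definition log_coef (n : nat) : R := / INR n.
Definition dilog_coef (n : nat) : R := / INR n ^ 2.
Definition odd_coef (n : nat) : R := / (2 * INR n + 1).

Lemma log_coef_bounded (n : nat) : Rabs (log_coef n) <= 1.
Proof. apply Rabs_inv_ge1, INR_0_or_ge1. Qed.

Lemma dilog_coef_bounded (n : nat) : Rabs (dilog_coef n) <= 1.
Proof.
  apply Rabs_inv_ge1; destruct (INR_0_or_ge1 n) as [H | H]; [left; rewrite H; ring | right; nra].
Qed.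

Lemma odd_coef_bounded (n : nat) : Rabs (odd_coef n) <= 1.
Proof. apply Rabs_inv_ge1; right; pose proof (pos_INR n); lra. Qed.

Lemma is_derive_log_series (x : R) :
  Rabs x < 1 -> is_derive (PSeries log_coef) x (/ (1 - x)).
Proof.
  intros Hx.
  replace (/ (1 - x)) with (PSeries (PS_derive log_coef) x).
  { apply is_derive_PSeries, CV_radius_bounded_coef; auto using log_coef_bounded. }
  rewrite <- Series_geom by exact Hx.
  apply Series_ext; intros n; unfold PS_derive, log_coef.
  field; apply not_0_INR; lia.
Qed.

Lemma log_series (x : R) : Rabs x < 1 -> PSeries log_coef x = - ln (1 - x).
Proof.
  intros Hx.
  enough (E : PSeries log_coef 0 + ln (1 - 0) = PSeries log_coef x + ln (1 - x)).
  { rewrite PSeries_0 in E; unfold log_coef at 1 in E; simpl in E.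
    rewrite Rinv_0, Rminus_0_r, ln_1 in E; lra. }
  apply (is_derive_0_eq (fun t => PSeries log_coef t + ln (1 - t))).
  intros t Ht.
  assert (Ht1 : Rabs t < 1).
  { revert Ht Hx; unfold Rmin, Rmax; destruct Rle_dec; split_Rabs; lra. }
  assert (0 < 1 - t) by (revert Ht1; split_Rabs; lra).
  replace 0 with (/ (1 - t) + - / (1 - t)) by lra.
  apply (is_derive_plus (PSeries log_coef) (fun t => ln (1 - t))).
  - now apply is_derive_log_series.
  - auto_derive; [assumption | field; lra].
Qed.

(** The power series has a zero term at index 0, so the two sums differ only by a shift of the
    index. *)
Lemma Li2_PSeries (x : R) : ex_pseries dilog_coef x -> Li2 x = PSeries dilog_coef x.
Proof.
  intros H; unfold Li2, PSeries.
  rewrite (Series_incr_1 (fun n => dilog_coef n * x ^ n)) by now apply ex_pseries_R.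
  unfold dilog_coef at 1; simpl (INR 0).
  rewrite pow_i, Rinv_0, Rmult_0_l, Rplus_0_l by lia; clear H.
  apply Series_ext; intros n; unfold dilog_coef, Rdiv; ring.
Qed.

(** The derivative of [Li2], that is - ln(1 - x)/x, kept as a power series so that it also has its
    correct value at 0. *)
Definition dLi2 : R -> R := PSeries (fun n => / INR (S n)).

Lemma dLi2_0 : dLi2 0 = 1.
Proof. unfold dLi2; rewrite PSeries_0; simpl; field. Qed.

Lemma dLi2_eq (x : R) : Rabs x < 1 -> x * dLi2 x = - ln (1 - x).
Proof.
  intros Hx; rewrite <- log_series by exact Hx.
  unfold dLi2; rewrite <- PSeries_incr_1.
  apply PSeries_ext; intros [| n]; unfold log_coef; simpl.
  - now rewrite Rinv_0.
  - reflexivity.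
Qed.

Lemma is_derive_Li2 (x : R) : Rabs x < 1 -> is_derive Li2 x (dLi2 x).
Proof.
  intros Hx.
  apply is_derive_ext_loc with (PSeries dilog_coef).
  (* [Li2_PSeries] asks for convergence, which holds on the ball of radius 1 - |x| about x; local
     equality is enough for the derivative. *)
  { assert (Hr : 0 < 1 - Rabs x) by lra.
    exists (mkposreal _ Hr); intros y Hy.
    assert (Hy1 : Rabs y < 1).
    { change (Rabs (y - x) < 1 - Rabs x) in Hy; revert Hy Hx; split_Rabs; lra. }
    symmetry; apply Li2_PSeries.
    apply CV_radius_inside, CV_radius_bounded_coef; auto using dilog_coef_bounded. }
  replace (dLi2 x) with (PSeries (PS_derive dilog_coef) x).
  { apply is_derive_PSeries, CV_radius_bounded_coef; auto using dilog_coef_bounded. }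
  apply PSeries_ext; intros n; unfold PS_derive, dilog_coef.
  field; apply not_0_INR; lia.
Qed.

Lemma Li2_0 : Li2 0 = 0.
Proof.
  rewrite Li2_PSeries.
  - rewrite PSeries_0; unfold dilog_coef; simpl; rewrite Rmult_0_l; apply Rinv_0.
  - apply CV_radius_inside, CV_radius_bounded_coef; auto using dilog_coef_bounded.
    rewrite Rabs_R0; lra.
Qed.

(** The function A(z) of the partial fraction formula. *)
Definition odd_series : R -> R := PSeries odd_coef.

(** The operator A + 2 z A' multiplies the n-th coefficient by 2n + 1, which turns the series into
    the geometric one. In this form no division by z occurs. *)
Lemma odd_series_derive (z : R) : Rabs z < 1 ->
  exists d, is_derive odd_series z d /\ odd_series z + 2 * z * d = / (1 - z).
Proof.
  intros Hz.
  assert (Hr : Rbar_lt (Rabs z) (CV_radius odd_coef))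
    by (apply CV_radius_bounded_coef; auto using odd_coef_bounded).
  exists (PSeries (PS_derive odd_coef) z); split.
  { now apply is_derive_PSeries. }
  assert (Hd : ex_pseries (PS_derive odd_coef) z) by now apply ex_pseries_derive.
  rewrite Rmult_assoc, <- PSeries_incr_1, <- PSeries_scal.
  unfold odd_series; rewrite <- PSeries_plus.
  - rewrite <- Series_geom by exact Hz.
    apply Series_ext; intros n.
    rewrite <- (Rmult_1_l (z ^ n)) at 2; f_equal.
    destruct n as [| n].
    + change (/ (2 * 0 + 1) + 2 * 0 = 1); field.
    + change (/ (2 * INR (S n) + 1) + 2 * (INR (S n) * / (2 * INR (S n) + 1)) = 1).
      pose proof (pos_INR (S n)); field; lra.
  - now apply CV_radius_inside.
  - apply ex_pseries_scal; [apply Rmult_comm | now apply ex_pseries_incr_1].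
Qed.

(** The derivative of t A(t^2) is A(t^2) + 2 t^2 A'(t^2) = 1/(1 - t^2), by [odd_series_derive] at
    t^2, and both sides vanish at 0. *)
Lemma odd_series_arctanh (t : R) : Rabs t < 1 -> t * odd_series (t ^ 2) = arctanh t.
Proof.
  intros Ht.
  enough (E : 0 * odd_series (0 ^ 2) - / 2 * ln (1 + 0) + / 2 * ln (1 - 0)
     = t * odd_series (t ^ 2) - / 2 * ln (1 + t) + / 2 * ln (1 - t)).
  { rewrite Rplus_0_r, Rminus_0_r, ln_1 in E; unfold arctanh.
    revert Ht; split_Rabs; rewrite ln_div by lra; lra. }
  apply (is_derive_0_eq
    (fun t => t * odd_series (t ^ 2) - / 2 * ln (1 + t) + / 2 * ln (1 - t))).
  intros s Hs.
  assert (Hs1 : -1 < s < 1).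
  { revert Hs Ht; unfold Rmin, Rmax; destruct Rle_dec; split_Rabs; lra. }
  destruct (odd_series_derive (s ^ 2)) as [d [Hd E]].
  { rewrite Rabs_pos_eq by nra; nra. }
  auto_derive.
  - repeat split; try lra. exists d. replace (s * (s * 1)) with (s ^ 2) by ring. exact Hd.
  - replace (s * (s * 1)) with (s ^ 2) by ring.
    match goal with |- context [Derive ?f ?u] =>
      replace (Derive f u) with d by (symmetry; exact (is_derive_unique _ _ _ Hd)) end.
    replace (odd_series (s^2)) with (/ (1 - s ^ 2) - 2 * s ^ 2 * d) by lra.
    field; repeat split; nra.
Qed.

(** The same argument at -t^2, where the common derivative is 1/(1 + t^2). *)
Lemma odd_series_atan (t : R) : Rabs t < 1 -> t * odd_series (- t ^ 2) = atan t.
Proof.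
  intros Ht.
  enough (E : 0 * odd_series (- 0 ^ 2) - atan 0 = t * odd_series (- t ^ 2) - atan t).
  { rewrite atan_0 in E; lra. }
  apply (is_derive_0_eq (fun t => t * odd_series (- t ^ 2) - atan t)).
  intros s Hs.
  assert (Hs1 : -1 < s < 1).
  { revert Hs Ht; unfold Rmin, Rmax; destruct Rle_dec; split_Rabs; lra. }
  destruct (odd_series_derive (- s ^ 2)) as [d [Hd E]].
  { rewrite Rabs_Ropp, Rabs_pos_eq by nra; nra. }
  auto_derive.
  - repeat split; try lra. exists d. replace (s * (s * 1)) with (s ^ 2) by ring. exact Hd.
  - replace (s * (s * 1)) with (s ^ 2) by ring.
    match goal with |- context [Derive ?f ?u] =>
      replace (Derive f u) with d by (symmetry; exact (is_derive_unique _ _ _ Hd)) end.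
    replace (odd_series (- s^2)) with (/ (1 - - s ^ 2) - 2 * (- s ^ 2) * d) by lra.
    field; repeat split; nra.
Qed.

(** The partial sums are 1 - 1/(n + 2). Twice this series dominates the sum of the inverse
    squares. *)
Lemma is_series_telescope : is_series (fun n => / (INR (S n) * INR (S (S n)))) 1.
Proof.
  change (is_lim_seq (sum_n (fun n => / (INR (S n) * INR (S (S n))))) 1).
  apply (is_lim_seq_ext (fun n => 1 - / INR (S (S n)))).
  - intros n; induction n as [| n IH].
    + rewrite sum_O; simpl; field.
    + rewrite sum_Sn, <- IH.
      change (1 - / INR (S (S (S n))) =
        1 - / INR (S (S n)) + / (INR (S (S n)) * INR (S (S (S n))))).
      rewrite !S_INR; pose proof (pos_INR n); field; lra.
  - replace (Finite 1) with (Rbar_minus 1 0) by (simpl; f_equal; ring).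
    apply is_lim_seq_minus'; [apply is_lim_seq_const |].
    apply (is_lim_seq_inv _ p_infty); [| discriminate].
    apply (is_lim_seq_ext (fun n => INR (n + 2))).
    { intros n; f_equal; lia. }
    apply -> (is_lim_seq_incr_n INR 2); exact is_lim_seq_INR.
Qed.

Lemma ex_series_inv_sqr : ex_series (fun n => / INR (S n) ^ 2).
Proof.
  apply (ex_series_le (K := R_AbsRing) (V := R_CompleteNormedModule)
    _ (fun n => 2 * / (INR (S n) * INR (S (S n))))).
  - intros n; change (Rabs (/ INR (S n) ^ 2) <= 2 * / (INR (S n) * INR (S (S n)))).
    pose proof (pos_INR n); rewrite !S_INR.
    rewrite Rabs_pos_eq by (left; apply Rinv_0_lt_compat; nra).
    apply Rmult_le_reg_l with ((INR n + 1) ^ 2 * (INR n + 1 + 1)); [nra |].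
    field_simplify; nra.
  - apply (ex_series_scal_l 2 (fun n => / (INR (S n) * INR (S (S n))))).
    exists 1; exact is_series_telescope.
Qed.

Lemma Rabs_pow_le1 (x : R) (n : nat) : Rabs x <= 1 -> Rabs (x ^ n) <= 1.
Proof.
  intros Hx; rewrite <- RPow_abs, <- (pow1 n); apply pow_incr; split; [apply Rabs_pos | exact Hx].
Qed.

Lemma dilog_term_bound (x : R) (n : nat) :
  Rabs x <= 1 -> Rabs (x ^ S n / INR (S n) ^ 2) <= / INR (S n) ^ 2.
Proof.
  intros Hx.
  assert (0 < / INR (S n) ^ 2).
  { apply Rinv_0_lt_compat, pow_lt, lt_0_INR; lia. }
  unfold Rdiv; rewrite Rabs_mult, (Rabs_pos_eq (/ _)) by lra.
  pose proof (Rabs_pow_le1 x (S n) Hx); nra.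
Qed.

Lemma is_series_Li2 (x : R) :
  Rabs x <= 1 -> is_series (fun n => x ^ S n / INR (S n) ^ 2) (Li2 x).
Proof.
  intros Hx; apply Series_correct.
  apply (ex_series_le (K := R_AbsRing) (V := R_CompleteNormedModule)
    _ (fun n => / INR (S n) ^ 2)).
  - intros n; now apply dilog_term_bound.
  - exact ex_series_inv_sqr.
Qed.

(** Partial fractions: the coefficient of z^k equals 1/(2(2k - 1)) - 1/(2(2k + 1)) - 1/(4k^2). *)
Lemma is_series_dilog_kernel (z : R) : Rabs z < 1 ->
  is_series
    (fun n => z ^ S n / ((2 * INR (S n) - 1) * (2 * INR (S n)) ^ 2 * (2 * INR (S n) + 1)))
    (/ 2 - / 2 * (1 - z) * odd_series z - / 4 * Li2 z).
Proof.
  intros Hz.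
  assert (H1 : is_series (fun n => odd_coef n * z ^ n) (odd_series z)).
  { apply is_pseries_R, PSeries_correct, CV_radius_inside, CV_radius_bounded_coef;
      auto using odd_coef_bounded. }
  assert (H2 : is_series (fun n => odd_coef (S n) * z ^ S n) (odd_series z - 1)).
  { apply (is_series_incr_1 (fun n => odd_coef n * z ^ n)).
    replace (plus _ _) with (odd_series z); [exact H1 |].
    unfold plus, odd_coef; simpl; field. }
  assert (H3 : is_series (fun n => z ^ S n / INR (S n) ^ 2) (Li2 z))
    by (apply is_series_Li2; lra).
  (* With k = n + 1, [H1] times z/2 supplies the part with 2k - 1, and the shifted series [H2] the
     part with 2k + 1. *)
  apply (is_series_scal_l (/ 2 * z)) in H1.
  apply (is_series_scal_l (/ 2)) in H2.
  apply (is_series_scal_l (/ 4)) in H3.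
  pose proof (is_series_minus _ _ _ _ (is_series_minus _ _ _ _ H1 H2) H3) as H.
  replace (/ 2 - / 2 * (1 - z) * odd_series z - / 4 * Li2 z) with
    (plus (plus (scal (/ 2 * z) (odd_series z)) (opp (scal (/ 2) (odd_series z - 1))))
       (opp (scal (/ 4) (Li2 z)))).
  2: { unfold plus, opp, scal; simpl; unfold mult; simpl; ring. }
  revert H; apply is_series_ext; intros n.
  change (/ 2 * z * (odd_coef n * z ^ n) - / 2 * (odd_coef (S n) * z ^ S n)
    - / 4 * (z ^ S n / INR (S n) ^ 2) =
    z ^ S n / ((2 * INR (S n) - 1) * (2 * INR (S n)) ^ 2 * (2 * INR (S n) + 1))).
  unfold odd_coef; rewrite <- tech_pow_Rmult, S_INR; pose proof (pos_INR n).
  field; lra.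
Qed.

(** The even and odd splitting of a power series, taken at the argument 1. *)
Lemma is_series_even_odd (u : nat -> R) (l1 l2 : R) :
  is_series (fun n => u (2 * n)%nat) l1 -> is_series (fun n => u (2 * n + 1)%nat) l2 ->
  is_series u (l1 + l2).
Proof.
  intros H1 H2.
  assert (Hp : forall (v : nat -> R) (l : R), is_series v l -> is_pseries v (1 ^ 2) l).
  { intros v l H; apply is_pseries_R; revert H; apply is_series_ext; intros n.
    now rewrite !pow1, Rmult_1_r. }
  pose proof (is_pseries_odd_even u 1 l1 l2 (Hp _ _ H1) (Hp _ _ H2)) as H.
  apply is_pseries_R in H; rewrite Rmult_1_l in H.
  revert H; apply is_series_ext; intros n; now rewrite pow1, Rmult_1_r.
Qed.

Lemma Li2_duplication (x : R) : Rabs x <= 1 -> Li2 x + Li2 (- x) = / 2 * Li2 (x ^ 2).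
Proof.
  intros Hx.
  assert (Hx2 : Rabs (x ^ 2) <= 1) by now apply Rabs_pow_le1.
  pose proof (is_series_plus _ _ _ _ (is_series_Li2 x Hx)
    (is_series_Li2 (- x) ltac:(now rewrite Rabs_Ropp))) as H.
  change (plus (Li2 x) (Li2 (- x))) with (Li2 x + Li2 (- x)) in H.
  rewrite <- (is_series_unique _ _ H), <- (Rplus_0_l (/ 2 * _)).
  apply is_series_unique, is_series_even_odd.
  (* The index 2n carries the odd exponent 2n + 1, so these terms cancel; the odd indices carry the
     even exponents. *)
  - apply is_series_ext with (fun _ => 0).
    + intros n.
      change (0 = x ^ S (2 * n) / INR (S (2 * n)) ^ 2 + (- x) ^ S (2 * n) / INR (S (2 * n)) ^ 2).
      rewrite <- !tech_pow_Rmult, !pow_mult; replace ((- x) ^ 2) with (x ^ 2) by ring.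
      unfold Rdiv; ring.
    + apply is_series_Reals; intros eps He; exists 0%nat; intros n _.
      rewrite sum_eq_R0 by reflexivity; now rewrite R_dist_eq.
  - generalize (is_series_scal_l (/ 2) _ _ (is_series_Li2 (x ^ 2) Hx2)).
    apply is_series_ext; intros n.
    change (/ 2 * ((x ^ 2) ^ S n / INR (S n) ^ 2) =
      x ^ S (2 * n + 1) / INR (S (2 * n + 1)) ^ 2 + (- x) ^ S (2 * n + 1) / INR (S (2 * n + 1)) ^ 2).
    replace (S (2 * n + 1)) with (2 * S n)%nat by lia.
    rewrite !pow_mult; replace ((- x) ^ 2) with (x ^ 2) by ring.
    rewrite mult_INR, (S_INR n); pose proof (pos_INR n); simpl (INR 2); field; lra.
Qed.

(** * Functional equations of the dilogarithm *)

(** The projection of the line onto [-1, 1], in a form whose continuity follows from that of the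
    absolute value. *)
Definition clip (x : R) : R := (Rabs (x + 1) - Rabs (x - 1)) / 2.

Lemma clip_bound (x : R) : Rabs (clip x) <= 1.
Proof. unfold clip; split_Rabs; lra. Qed.

Lemma clip_id (x : R) : Rabs x <= 1 -> clip x = x.
Proof. unfold clip; split_Rabs; lra. Qed.

Lemma continuous_clip (x : R) : continuous clip x.
Proof.
  apply (continuous_ext (fun t => / 2 * (Rabs (t + 1) - Rabs (t - 1)))).
  { intros t; unfold clip; lra. }
  apply (continuous_scal_r (/ 2) (fun t => Rabs (t + 1) - Rabs (t - 1))).
  apply (continuous_minus (fun t => Rabs (t + 1)) (fun t => Rabs (t - 1))).
  - apply (continuous_comp (fun t => t + 1) Rabs).
    + apply (ex_derive_continuous (fun t => t + 1)); auto_derive; exact I.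
    + apply continuous_Rabs.
  - apply (continuous_comp (fun t => t - 1) Rabs).
    + apply (ex_derive_continuous (fun t => t - 1)); auto_derive; exact I.
    + apply continuous_Rabs.
Qed.

(* Clipping makes the Weierstrass M-test applicable on a neighbourhood of the closed interval [-1, 1], where [Li2] itself does not converge. *)
Lemma continuous_Li2_clip (x : R) : continuous (fun t => Li2 (clip t)) x.
Proof.
  assert (Hr : 0 < Rabs x + 1) by (pose proof (Rabs_pos x); lra).
  pose (fn := fun (n : nat) (t : R) => clip t ^ S n / INR (S n) ^ 2).
  destruct (CVN_CVU_r fn (mkposreal _ Hr)) with (x := x) as [e He].
  - exists (fun n => / INR (S n) ^ 2).
    exists (Series (fun n => / INR (S n) ^ 2)); split.
    + generalize (proj1 (is_series_Reals _ _) (Series_correct _ ex_series_inv_sqr)).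
      unfold infinite_sum, Un_cv.
      intros Hl eps Heps; destruct (Hl eps Heps) as [N HN]; exists N; intros n Hn.
      erewrite sum_eq; [exact (HN n Hn) |].
      intros i _; apply Rabs_pos_eq; left; apply Rinv_0_lt_compat, pow_lt, lt_0_INR; lia.
    + intros n y _; apply dilog_term_bound, clip_bound.
  - simpl; lra.
  - apply continuity_pt_filterlim.
    apply (CVU_continuity _ _ _ _ He).
    2: { unfold Boule; rewrite Rminus_diag, Rabs_R0; apply cond_pos. }
    intros n y _; unfold SP; apply (continuity_pt_finite_SF fn).
    intros k _; unfold fn.
    apply continuity_pt_filterlim.
    apply (continuous_mult (fun t => clip t ^ S k) (fun _ => / INR (S k) ^ 2)).
    2: apply continuous_const.
    apply (continuous_comp clip (fun t => t ^ S k)); [apply continuous_clip |].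
    apply (ex_derive_continuous (fun t => t ^ S k)); auto_derive; exact I.
Qed.

Lemma Rabs_div_lt1 (a b : R) : Rabs a < b -> Rabs (a / b) < 1.
Proof.
  intros H; pose proof (Rabs_pos a).
  unfold Rdiv; rewrite Rabs_mult, (Rabs_pos_eq (/ b)) by (left; apply Rinv_0_lt_compat; lra).
  apply Rmult_lt_reg_r with b; [lra |].
  rewrite Rmult_assoc, Rinv_l by lra; lra.
Qed.

Lemma Rabs_div_le1 (a b : R) : 0 < b -> Rabs a <= b -> Rabs (a / b) <= 1.
Proof.
  intros Hb H.
  unfold Rdiv; rewrite Rabs_mult, (Rabs_pos_eq (/ b)) by (left; apply Rinv_0_lt_compat; lra).
  apply Rmult_le_reg_r with b; [lra |].
  rewrite Rmult_assoc, Rinv_l by lra; lra.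
Qed.

(** [dLi2_eq] for the quotient arguments of the functional equations, with the logarithm already
    split. *)
Lemma dLi2_div (a b : R) : Rabs a < b -> a / b * dLi2 (a / b) = ln b - ln (b - a).
Proof.
  intros H; assert (0 < b - a /\ 0 < b) by (revert H; split_Rabs; lra).
  rewrite dLi2_eq by now apply Rabs_div_lt1.
  replace (1 - a / b) with ((b - a) / b) by (field; lra).
  rewrite ln_div by lra; ring.
Qed.

Lemma is_derive_Li2_div (t : R) (u v : R -> R) (du dv : R) :
  is_derive u t du -> is_derive v t dv -> Rabs (u t) < v t ->
  is_derive (fun s => Li2 (u s / v s)) t
    ((du * v t - u t * dv) / v t ^ 2 * dLi2 (u t / v t)).
Proof.
  intros Hu Hv H; pose proof (Rabs_pos (u t)).
  apply (is_derive_comp Li2 (fun s => u s / v s)).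
  - apply is_derive_Li2, Rabs_div_lt1, H.
  - apply is_derive_div; [assumption.. | lra].
Qed.

(** For fixed y the difference of the two sides is constant in x: its derivative is a combination of
    logarithms that cancel. At x = 0 both sides vanish. *)
Lemma Li2_abel_interior (x y : R) : 0 <= x -> x + Rabs y < 1 ->
  Li2 (x / (1 - y)) + Li2 (y / (1 - x)) - Li2 x - Li2 y - Li2 (x * y / ((1 - x) * (1 - y)))
    = ln (1 - x) * ln (1 - y).
Proof.
  intros Hx Hxy.
  pose (f := fun t => Li2 (t / (1 - y)) + Li2 (y / (1 - t)) - Li2 t
    - Li2 (t * y / ((1 - t) * (1 - y))) - ln (1 - t) * ln (1 - y)).
  enough (E : f 0 = f x).
  { unfold f in E.
    replace (0 / (1 - y)) with 0 in E by (unfold Rdiv; ring).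
    replace (y / (1 - 0)) with y in E by field.
    replace (0 * y / ((1 - 0) * (1 - y))) with 0 in E by (unfold Rdiv; ring).
    rewrite Li2_0, !Rminus_0_r, ln_1 in E; lra. }
  apply is_derive_0_eq; intros t; rewrite Rmin_left, Rmax_right by lra; intros Ht.
  assert (Hy : -1 < y < 1) by (revert Hxy; split_Rabs; lra).
  assert (H1 : Rabs t < 1 - y) by (revert Hxy; split_Rabs; lra).
  assert (H2 : Rabs y < 1 - t) by (revert Hxy; split_Rabs; lra).
  assert (H3 : Rabs t < 1) by (revert Hxy; split_Rabs; lra).
  assert (H4 : Rabs (t * y) < (1 - t) * (1 - y)) by (revert Hxy; split_Rabs; nra).
  assert (H5 : 0 < 1 - t - y) by (revert H1; split_Rabs; lra).
  assert (H6 : 0 < 1 - t) by (revert H3; split_Rabs; lra).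
  evar_last.
  { unfold f.
    apply (is_derive_minus (fun t => _ - _ - Li2 (_ / _)) (fun t => ln (1 - t) * ln (1 - y))).
    2: { auto_derive; [lra | reflexivity]. }
    apply (is_derive_minus (fun t => _ - Li2 t) (fun t => Li2 (_ / _))).
    2: { apply (is_derive_Li2_div t (fun t => t * y) (fun t => (1 - t) * (1 - y)));
         [auto_derive; [exact I | reflexivity].. | exact H4]. }
    apply (is_derive_minus (fun t => _ + _) Li2).
    2: now apply is_derive_Li2.
    apply (is_derive_plus (fun t => Li2 (t / (1 - y))) (fun t => Li2 (y / (1 - t)))).
    - apply (is_derive_Li2_div t (fun t => t) (fun t => 1 - y));
        [auto_derive; [exact I | reflexivity].. | exact H1].
    - apply (is_derive_Li2_div t (fun t => y) (fun t => 1 - t));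
        [auto_derive; [exact I | reflexivity].. | exact H2]. }
  cbv beta.
  pose proof (dLi2_div _ _ H1) as E1.
  pose proof (dLi2_div _ _ H2) as E2.
  pose proof (dLi2_eq _ H3) as E3.
  pose proof (dLi2_div _ _ H4) as E4.
  (* After these rewritings only the logarithms of 1 - t, 1 - y and 1 - t - y occur. *)
  replace (1 - y - t) with (1 - t - y) in E1 by ring.
  replace ((1 - t) * (1 - y) - t * y) with (1 - t - y) in E4 by ring.
  rewrite ln_mult in E4 by lra.
  unfold minus, plus, opp; simpl.
  (* The logarithmic formulas give w * [dLi2] w only. For t nonzero, multiplying by t brings every
     term to that shape; at t = 0 the value [dLi2_0] is used. *)
  destruct (Req_dec t 0) as [-> | Ht0].
  - replace (0 / (1 - y)) with 0 by (unfold Rdiv; ring).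
    replace (0 * y / ((1 - 0) * (1 - y))) with 0 by (unfold Rdiv; ring).
    rewrite dLi2_0.
    rewrite !Rminus_0_r in *; rewrite ln_1 in E2.
    transitivity (y / 1 * dLi2 (y / 1) + ln (1 - y)); [field; lra | lra].
  - apply Rmult_eq_reg_l with t; [rewrite Rmult_0_r | exact Ht0].
    transitivity (t / (1 - y) * dLi2 (t / (1 - y))
      + t / (1 - t) * (y / (1 - t) * dLi2 (y / (1 - t))) - t * dLi2 t
      - / (1 - t) * (t * y / ((1 - t) * (1 - y)) * dLi2 (t * y / ((1 - t) * (1 - y))))
      + t / (1 - t) * ln (1 - y)).
    + field; lra.
    + rewrite E1, E2, E3, E4; field; lra.
Qed.

Lemma is_lim_seq_Li2 (u : nat -> R) (l : R) :
  is_lim_seq u l -> (forall n, Rabs (u n) <= 1) -> Rabs l <= 1 ->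
  is_lim_seq (fun n => Li2 (u n)) (Li2 l).
Proof.
  intros Hu Hb Hl.
  apply is_lim_seq_ext with (fun n => Li2 (clip (u n))).
  { intros n; now rewrite clip_id. }
  rewrite <- (clip_id l Hl).
  apply (is_lim_seq_continuous (fun t => Li2 (clip t)) u l); [| exact Hu].
  apply continuity_pt_filterlim, continuous_Li2_clip.
Qed.

(** The interior case holds along x (1 - 1/(n + 1)), which tends to x, and passes to the limit
    because [Li2] is continuous on the closed interval [-1, 1]. The boundary x + |y| = 1 is where
    arguments equal to 1 or -1 appear. *)
Lemma Li2_abel (x y : R) : 0 <= x < 1 -> -1 < y < 1 -> x + Rabs y <= 1 ->
  Li2 (x / (1 - y)) + Li2 (y / (1 - x)) - Li2 x - Li2 y - Li2 (x * y / ((1 - x) * (1 - y)))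
    = ln (1 - x) * ln (1 - y).
Proof.
  intros Hx Hy Hxy.
  pose (u := fun n => x * (1 - / INR (S n))).
  assert (Hi : forall n, 0 < / INR (S n) <= 1).
  { intros n; pose proof (pos_INR n); rewrite S_INR; split.
    - apply Rinv_0_lt_compat; lra.
    - rewrite <- Rinv_1; apply Rinv_le_contravar; lra. }
  assert (Hu0 : forall n, 0 <= u n <= x) by (intros n; specialize (Hi n); unfold u; nra).
  assert (Hu1 : forall n, u n + Rabs y < 1).
  (* If x = 0 the sequence is constantly 0 and strictness comes from |y| < 1; otherwise it comes
     from [u n] < x. *)
  { intros n; destruct (Req_dec x 0) as [-> | Hx0].
    - unfold u; split_Rabs; lra.
    - specialize (Hi n); unfold u; nra. }
  assert (Hlim : is_lim_seq u x).
  { replace (Finite x) with (Rbar_mult x (1 - 0)) by (simpl; f_equal; ring).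
    apply (is_lim_seq_scal_l (fun n => 1 - / INR (S n)) x (1 - 0)).
    apply is_lim_seq_minus'; [apply is_lim_seq_const |].
    apply (is_lim_seq_inv _ p_infty); [| discriminate].
    apply (is_lim_seq_incr_1 INR), is_lim_seq_INR. }
  assert (Hin : forall v : R -> R, continuity_pt v x ->
    (forall t, 0 <= t <= x -> Rabs (v t) <= 1) ->
    is_lim_seq (fun n => Li2 (v (u n))) (Li2 (v x))).
  { intros v Hc Hb; apply is_lim_seq_Li2; auto; [| apply Hb; lra].
    now apply is_lim_seq_continuous. }
  assert (Hd : forall v : R -> R, ex_derive v x -> continuity_pt v x).
  { intros v Hv; apply continuity_pt_filterlim, (ex_derive_continuous v x Hv). }
  assert (Hl : is_lim_seq (fun n => Li2 (u n / (1 - y)) + Li2 (y / (1 - u n)) - Li2 (u n) - Li2 y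
      - Li2 (u n * y / ((1 - u n) * (1 - y))))
    (Li2 (x / (1 - y)) + Li2 (y / (1 - x)) - Li2 x - Li2 y - Li2 (x * y / ((1 - x) * (1 - y))))).
  { repeat apply is_lim_seq_minus'; try apply is_lim_seq_plus'.
    - apply (Hin (fun t => t / (1 - y))).
      + apply Hd; auto_derive; lra.
      + intros t Ht; apply Rabs_div_le1; [lra |]. revert Hxy; split_Rabs; lra.
    - apply (Hin (fun t => y / (1 - t))).
      + apply Hd; auto_derive; lra.
      + intros t Ht; apply Rabs_div_le1; [lra |]. revert Hxy; split_Rabs; lra.
    - apply (Hin (fun t => t)).
      + apply Hd; auto_derive; exact I.
      + intros t Ht; split_Rabs; lra.
    - apply is_lim_seq_const.
    - apply (Hin (fun t => t * y / ((1 - t) * (1 - y)))).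
      + apply Hd; auto_derive; repeat split; nra.
      + intros t Ht; apply Rabs_div_le1; [nra |]. revert Hxy; split_Rabs; nra. }
  assert (Hr : is_lim_seq (fun n => ln (1 - u n) * ln (1 - y)) (ln (1 - x) * ln (1 - y))).
  { apply (is_lim_seq_continuous (fun t => ln (1 - t) * ln (1 - y)) u x); [| exact Hlim].
    apply Hd; auto_derive; lra. }
  apply (is_lim_seq_ext _ _ _ (fun n => Li2_abel_interior _ y (proj1 (Hu0 n)) (Hu1 n))) in Hl.
  apply is_lim_seq_unique in Hl; apply is_lim_seq_unique in Hr.
  rewrite Hl in Hr; now injection Hr.
Qed.

(** Abel's relation at y = 1 - x, where all three quotient arguments equal 1. *)
Lemma Li2_reflection (x : R) : 0 < x < 1 ->
  Li2 x + Li2 (1 - x) = Li2 1 - ln x * ln (1 - x).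
Proof.
  intros Hx.
  pose proof (Li2_abel x (1 - x)) as H.
  replace (1 - (1 - x)) with x in H by ring.
  replace (x / x) with 1 in H by (field; lra).
  replace ((1 - x) / (1 - x)) with 1 in H by (field; lra).
  replace (x * (1 - x) / ((1 - x) * x)) with 1 in H by (field; lra).
  rewrite (Rabs_pos_eq (1 - x)) in H by lra.
  specialize (H ltac:(lra) ltac:(lra) ltac:(lra)); lra.
Qed.

(** Differentiation again, both sides being 0 at z = 0. The bound z < 1/2 keeps z/(1 - z) below
    1. *)
Lemma Li2_landen (z : R) : -1 < z < / 2 ->
  Li2 z + Li2 (- (z / (1 - z))) = - / 2 * ln (1 - z) ^ 2.
Proof.
  intros Hz.
  pose (f := fun t => Li2 t + Li2 (- t / (1 - t)) + / 2 * ln (1 - t) ^ 2).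
  enough (E : f 0 = f z).
  { unfold f in E.
    replace (- 0 / (1 - 0)) with 0 in E by field.
    rewrite Li2_0, Rminus_0_r, ln_1 in E.
    replace (- (z / (1 - z))) with (- z / (1 - z)) by (field; lra); lra. }
  apply is_derive_0_eq; intros t Ht'.
  assert (Ht : -1 < t < / 2) by (revert Ht'; unfold Rmin, Rmax; destruct Rle_dec; lra).
  assert (H1 : Rabs t < 1) by (split_Rabs; lra).
  assert (H2 : Rabs (- t) < 1 - t) by (split_Rabs; lra).
  evar_last.
  { unfold f.
    apply (is_derive_plus (fun t => Li2 t + Li2 (_ / _)) (fun t => / 2 * ln (1 - t) ^ 2)).
    2: { auto_derive; [lra | reflexivity]. }
    apply (is_derive_plus Li2 (fun t => Li2 (_ / _))).
    - now apply is_derive_Li2.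
    - apply (is_derive_Li2_div t (fun t => - t) (fun t => 1 - t));
        [auto_derive; [exact I | reflexivity].. | exact H2]. }
  cbv beta; unfold plus; simpl.
  pose proof (dLi2_eq _ H1) as E1.
  pose proof (dLi2_div _ _ H2) as E2.
  replace (1 - t - - t) with 1 in E2 by ring; rewrite ln_1 in E2.
  destruct (Req_dec t 0) as [-> | Ht0].
  - replace (- 0 / (1 - 0)) with 0 by field.
    rewrite dLi2_0, Rminus_0_r; replace (1 + - 0) with 1 by ring; rewrite ln_1; field.
  - change (1 + - t) with (1 - t).
    apply Rmult_eq_reg_l with t; [rewrite Rmult_0_r | exact Ht0].
    transitivity (t * dLi2 t + / (1 - t) * (- t / (1 - t) * dLi2 (- t / (1 - t)))
      - t / (1 - t) * ln (1 - t)).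
    + field; lra.
    + rewrite E1, E2; field; lra.
Qed.

(** * The value of the dilogarithm at 1 *)

(** The upper index is excluded, unlike in [sum_n], so that blocks of 2^n terms can be split and
    joined without offsets. *)
Fixpoint psum (f : nat -> R) (n : nat) : R :=
  match n with O => 0 | S m => psum f m + f m end.

Lemma psum_sum_n (f : nat -> R) (n : nat) : psum f (S n) = sum_n f n.
Proof.
  induction n as [| n IH].
  - rewrite sum_O; simpl; ring.
  - rewrite sum_Sn, <- IH; reflexivity.
Qed.

Lemma psum_ext (f g : nat -> R) (n : nat) :
  (forall k, (k < n)%nat -> f k = g k) -> psum f n = psum g n.
Proof.
  induction n as [| n IH]; intros H; simpl; [reflexivity |].
  rewrite IH, H by auto with arith; reflexivity.
Qed.

Lemma psum_le (f g : nat -> R) (n : nat) :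
  (forall k, (k < n)%nat -> f k <= g k) -> psum f n <= psum g n.
Proof.
  induction n as [| n IH]; intros H; simpl; [lra |].
  apply Rplus_le_compat; [apply IH | apply H]; auto with arith.
Qed.

Lemma psum_affine (f : nat -> R) (a b : R) (n : nat) :
  psum (fun k => a * f k + b) n = a * psum f n + b * INR n.
Proof.
  induction n as [| n IH]; [simpl; ring |].
  rewrite S_INR; simpl; rewrite IH; ring.
Qed.

Lemma psum_head (f : nat -> R) (n : nat) :
  psum f (S n) = f 0%nat + psum (fun k => f (S k)) n.
Proof.
  induction n as [| n IH]; [simpl; ring |].
  change (psum f (S n) + f (S n) = f 0%nat + (psum (fun k => f (S k)) n + f (S n))).
  rewrite IH; ring.
Qed.

(** The second block is read backwards; for n = m this pairs k with 2n - 1 - k. *)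
Lemma psum_fold (f : nat -> R) (n m : nat) :
  psum f (n + m) = psum f n + psum (fun k => f (n + m - 1 - k)%nat) m.
Proof.
  induction m as [| m IH].
  - rewrite Nat.add_0_r; simpl; ring.
  - rewrite psum_head, Nat.add_succ_r; simpl psum at 1; rewrite IH.
    rewrite (psum_ext (fun k => f (S (n + m) - 1 - S k)%nat) (fun k => f (n + m - 1 - k)%nat))
      by (intros; f_equal; lia).
    replace (S (n + m) - 1 - 0)%nat with (n + m)%nat by lia; ring.
Qed.

Lemma psum_plus (f g : nat -> R) (n : nat) :
  psum (fun k => f k + g k) n = psum f n + psum g n.
Proof. induction n as [| n IH]; simpl; [ring | rewrite IH; ring]. Qed.

(** For k < 2^n these are the odd multiples of PI/2^(n+2) in the first quadrant. *)
Definition dyadic_angle (n k : nat) : R := (2 * INR k + 1) * PI / 2 ^ (n + 2).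

Lemma INR_pow2 (n : nat) : INR (2 ^ n) = 2 ^ n.
Proof. now rewrite pow_INR. Qed.

Lemma two_pow_pos (n : nat) : 0 < 2 ^ n.
Proof. apply pow_lt; lra. Qed.

Lemma dyadic_angle_bound (n k : nat) :
  (k < 2 ^ n)%nat -> 0 < dyadic_angle n k < PI / 2.
Proof.
  intros Hk; unfold dyadic_angle; rewrite pow_add.
  assert (H : INR k + 1 <= 2 ^ n).
  { rewrite <- INR_pow2, <- S_INR; apply le_INR; exact Hk. }
  pose proof (pos_INR k); pose proof PI_RGT_0; pose proof (two_pow_pos n).
  split.
  - apply Rdiv_lt_0_compat; nra.
  - apply Rmult_lt_reg_r with (2 ^ n * 2 ^ 2); [nra |].
    unfold Rdiv at 1; rewrite Rmult_assoc, Rinv_l by nra; nra.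
Qed.

(* Pairing [k] with [2^(n+1) - 1 - k] pairs each angle with its complement, and [1/sin^2 + 1/cos^2] at an angle is [4/sin^2] at its double. *)
Lemma psum_inv_sin_sqr (n : nat) :
  psum (fun k => / sin (dyadic_angle n k) ^ 2) (2 ^ n) = 2 * 4 ^ n.
Proof.
  induction n as [| n IH].
  - change (0 + / sin (dyadic_angle 0 0) ^ 2 = 2 * 1); unfold dyadic_angle; simpl INR.
    replace ((2 * 0 + 1) * PI / 2 ^ (0 + 2)) with (PI / 4) by (simpl; field).
    rewrite sin_PI4.
    replace ((1 / sqrt 2) ^ 2) with (/ sqrt 2 ^ 2) by (field; apply sqrt2_neq_0).
    rewrite pow2_sqrt by lra; field.
  - replace (2 ^ S n)%nat with (2 ^ n + 2 ^ n)%nat by (simpl; lia).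
    rewrite psum_fold, <- psum_plus.
    transitivity (4 * psum (fun k => / sin (dyadic_angle n k) ^ 2) (2 ^ n) + 0 * INR (2 ^ n)).
    2: { rewrite IH; simpl; ring. }
    rewrite <- psum_affine; apply psum_ext; intros k Hk.
    assert (H2n := two_pow_pos n).
    pose proof (dyadic_angle_bound n k Hk) as Hb.
    set (t := dyadic_angle (S n) k).
    assert (E8 : 2 ^ (S n + 2) = 8 * 2 ^ n) by (rewrite pow_add; simpl; ring).
    replace (dyadic_angle (S n) (2 ^ n + 2 ^ n - 1 - k)) with (PI / 2 - t).
    2: { unfold t, dyadic_angle; rewrite !minus_INR, plus_INR, INR_pow2 by lia.
         rewrite E8; simpl INR; field; lra. }
    assert (E : dyadic_angle n k = 2 * t).
    { unfold t, dyadic_angle; rewrite E8, pow_add; field; lra. }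
    rewrite E in *; rewrite sin_shift, sin_2a.
    assert (0 < sin t) by (apply sin_gt_0; lra).
    assert (0 < cos t) by (apply cos_gt_0; lra).
    pose proof (sin2_cos2 t) as Hsc; unfold Rsqr in Hsc.
    transitivity ((sin t * sin t + cos t * cos t) / (sin t ^ 2 * cos t ^ 2)); [field; lra |].
    rewrite Hsc; field; lra.
Qed.

(** This is t <= tan t without a division: sin s - s cos s has the nonnegative derivative s sin
    s. *)
Lemma mul_cos_le_sin (t : R) : 0 < t < PI / 2 -> t * cos t <= sin t.
Proof.
  intros Ht.
  destruct (MVT_cor2 (fun s => sin s - s * cos s) (fun s => s * sin s) 0 t) as [c [Hc Hc']].
  - lra.
  - intros c Hc; apply is_derive_Reals; auto_derive; [exact I | ring].
  - rewrite sin_0 in Hc; pose proof PI_RGT_0; assert (0 <= sin c) by (apply sin_ge_0; lra).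
    assert (0 <= c * sin c * (t - 0)) by (repeat apply Rmult_le_pos; lra); lra.
Qed.

(** Squares and inverts sin t < t <= tan t, with 1/tan^2 = 1/sin^2 - 1. *)
Lemma inv_sqr_sandwich (t : R) : 0 < t < PI / 2 -> / sin t ^ 2 - 1 <= / t ^ 2 <= / sin t ^ 2.
Proof.
  intros Ht.
  assert (Hs : 0 < sin t) by (apply sin_gt_0; lra).
  assert (Hc : 0 < cos t) by (apply cos_gt_0; lra).
  assert (Hst : sin t < t) by (apply sin_lt_x; lra).
  pose proof (mul_cos_le_sin t Ht) as Htc.
  pose proof (sin2_cos2 t) as Hsc; unfold Rsqr in Hsc.
  split.
  - replace (/ sin t ^ 2 - 1) with (/ (sin t / cos t) ^ 2).
    2: { transitivity (cos t ^ 2 / sin t ^ 2); [field; lra |].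
         replace (cos t ^ 2) with (1 - sin t ^ 2) by lra; field; lra. }
    apply Rinv_le_contravar; [apply pow_lt; lra |].
    apply pow_incr; split; [lra |].
    apply Rmult_le_reg_r with (cos t); [exact Hc |].
    unfold Rdiv; rewrite Rmult_assoc, Rinv_l by lra; lra.
  - apply Rinv_le_contravar; [apply pow_lt; lra | apply pow_incr; lra].
Qed.

(** The sandwich is summed over the 2^n dyadic angles and scaled by PI^2/(16 * 4^n). The 2^n
    subtracted ones become the error PI^2/16 * 2^(-n). *)
Lemma psum_odd_inv_sqr_bound (n : nat) :
  PI ^ 2 / 8 - PI ^ 2 / 16 * (/ 2) ^ n
    <= psum (fun k => / (2 * INR k + 1) ^ 2) (2 ^ n) <= PI ^ 2 / 8.
Proof.
  set (O := psum _ _).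
  pose proof PI_RGT_0 as HPI; pose proof (two_pow_pos n) as H2.
  assert (HO : psum (fun k => / dyadic_angle n k ^ 2) (2 ^ n) = 16 * 4 ^ n / PI ^ 2 * O).
  { transitivity (16 * 4 ^ n / PI ^ 2 * O + 0 * INR (2 ^ n)); [| ring].
    unfold O; rewrite <- psum_affine; apply psum_ext; intros k _.
    unfold dyadic_angle; rewrite pow_add.
    replace 4 with (2 * 2) by ring; rewrite Rpow_mult_distr.
    pose proof (pos_INR k); field; repeat split; lra. }
  assert (Hup := psum_le _ _ _ (fun k Hk => proj2 (inv_sqr_sandwich _ (dyadic_angle_bound n k Hk)))).
  assert (Hlo := psum_le _ _ _ (fun k Hk => proj1 (inv_sqr_sandwich _ (dyadic_angle_bound n k Hk)))).
  cbv beta in Hup, Hlo.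
  rewrite HO, psum_inv_sin_sqr in Hup; rewrite HO in Hlo.
  rewrite (psum_ext _ (fun k => 1 * / sin (dyadic_angle n k) ^ 2 + -1)) in Hlo
    by (intros; ring).
  rewrite psum_affine, psum_inv_sin_sqr, INR_pow2 in Hlo.
  rewrite pow_inv.
  assert (H4 : 4 ^ n = 2 ^ n * 2 ^ n) by (rewrite <- Rpow_mult_distr; f_equal; ring).
  rewrite H4 in *.
  assert (Hc : 0 < PI ^ 2 / (16 * (2 ^ n * 2 ^ n))) by (apply Rdiv_lt_0_compat; nra).
  apply (Rmult_le_compat_l _ _ _ (Rlt_le _ _ Hc)) in Hup.
  apply (Rmult_le_compat_l _ _ _ (Rlt_le _ _ Hc)) in Hlo.
  split.
  - eapply Rle_trans; [| eapply Rle_trans; [exact Hlo |]]; right; field; lra.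
  - eapply Rle_trans; [| eapply Rle_trans; [exact Hup |]]; right; field; lra.
Qed.

(** Comparison gives convergence, so the sum can be identified along the partial sums of 2^n terms
    alone. *)
Lemma is_series_odd_inv_sqr : is_series (fun k => / (2 * INR k + 1) ^ 2) (PI ^ 2 / 8).
Proof.
  assert (Hex : ex_series (fun k => / (2 * INR k + 1) ^ 2)).
  { apply (ex_series_le (K := R_AbsRing) (V := R_CompleteNormedModule)
      _ (fun n => / INR (S n) ^ 2)); [| exact ex_series_inv_sqr].
    intros n; change (Rabs (/ (2 * INR n + 1) ^ 2) <= / INR (S n) ^ 2).
    pose proof (pos_INR n); rewrite S_INR.
    rewrite Rabs_pos_eq by (left; apply Rinv_0_lt_compat; nra).
    apply Rinv_le_contravar; nra. }
  destruct Hex as [l Hl].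
  replace (PI ^ 2 / 8) with l; [exact Hl |].
  assert (Hsub : is_lim_seq (fun n => psum (fun k => / (2 * INR k + 1) ^ 2) (2 ^ n)) l).
  (* [sum_n] includes its last index, hence 2^n - 1. *)
  { apply is_lim_seq_ext with (fun n => sum_n (fun k => / (2 * INR k + 1) ^ 2) (2 ^ n - 1)).
    - intros n; rewrite <- psum_sum_n; f_equal.
      pose proof (Nat.pow_nonzero 2 n); lia.
    - apply (is_lim_seq_subseq (sum_n (fun k => / (2 * INR k + 1) ^ 2)) l (fun n => (2 ^ n - 1)%nat)).
      + apply eventually_subseq; intros n; simpl.
        pose proof (Nat.pow_nonzero 2 n); lia.
      + exact Hl. }
  assert (Hsq : is_lim_seq (fun n => psum (fun k => / (2 * INR k + 1) ^ 2) (2 ^ n)) (PI ^ 2 / 8)).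
  { apply (is_lim_seq_le_le _ _ _ _ psum_odd_inv_sqr_bound); [| apply is_lim_seq_const].
    replace (Finite (PI ^ 2 / 8)) with (Finite (PI ^ 2 / 8 - PI ^ 2 / 16 * 0)) by (f_equal; ring).
    apply is_lim_seq_minus'; [apply is_lim_seq_const |].
    apply (is_lim_seq_scal_l _ (PI ^ 2 / 16) 0), is_lim_seq_geom.
    rewrite Rabs_pos_eq; lra. }
  apply is_lim_seq_unique in Hsub; apply is_lim_seq_unique in Hsq.
  rewrite Hsub in Hsq; now injection Hsq.
Qed.

(** The odd denominators contribute PI^2/8 and the even ones a quarter of the whole sum, a linear
    equation for [Li2 1]. *)
Lemma Li2_1 : Li2 1 = PI ^ 2 / 6.
Proof.
  assert (H1 : Rabs 1 <= 1) by (rewrite Rabs_R1; lra).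
  pose proof (is_series_Li2 1 H1) as H.
  enough (E : Li2 1 = PI ^ 2 / 8 + / 4 * Li2 1) by lra.
  rewrite <- (is_series_unique _ _ H) at 1.
  apply is_series_unique, is_series_even_odd.
  - generalize is_series_odd_inv_sqr; apply is_series_ext; intros n.
    rewrite pow1, S_INR, mult_INR; simpl (INR 2); unfold Rdiv; now rewrite Rmult_1_l.
  - generalize (is_series_scal_l (/ 4) _ _ H); apply is_series_ext; intros n.
    change (/ 4 * (1 ^ S n / INR (S n) ^ 2) = 1 ^ S (2 * n + 1) / INR (S (2 * n + 1)) ^ 2).
    replace (S (2 * n + 1)) with (2 * S n)%nat by lia.
    rewrite !pow1, mult_INR, S_INR; pose proof (pos_INR n); simpl (INR 2); field; lra.
Qed.

Lemma Li2_m1 : Li2 (-1) = - PI ^ 2 / 12.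
Proof.
  pose proof (Li2_duplication 1) as H; rewrite Rabs_R1, pow1, Li2_1 in H.
  replace (-1) with (- (1)) by ring; specialize (H ltac:(lra)); lra.
Qed.

(** * Golden-ratio evaluations *)

Lemma sqrt5_sqr : sqrt 5 * sqrt 5 = 5.
Proof. apply sqrt_sqrt; lra. Qed.

Lemma sqrt5_alpha : sqrt 5 = 2 * alpha - 1.
Proof. unfold alpha; field. Qed.

Lemma alpha_sqr : alpha * alpha = alpha + 1.
Proof. unfold alpha; pose proof sqrt5_sqr; nra. Qed.

Lemma alpha_bounds : 8 / 5 < alpha < 17 / 10.
Proof.
  unfold alpha; pose proof sqrt5_sqr; pose proof (sqrt_pos 5); split; nra.
Qed.

Lemma inv_alpha : / alpha = alpha - 1.
Proof.
  pose proof alpha_sqr; pose proof alpha_bounds.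
  apply Rmult_eq_reg_l with alpha; [rewrite Rinv_r; lra | lra].
Qed.

Lemma beta_alpha : beta = - / alpha.
Proof. rewrite inv_alpha; unfold beta, alpha; field. Qed.

(** Proves identities between rational expressions in [alpha] by reducing modulo its quadratic
    equation; the numerical bounds show that the denominators are nonzero. *)
Ltac golden_field :=
  pose proof alpha_sqr as golden_eq; field [golden_eq];
  pose proof alpha_bounds; repeat split; try lra; try nra.

Lemma ln_inv_alpha : ln (/ alpha) = - ln alpha.
Proof. pose proof alpha_bounds; apply ln_Rinv; lra. Qed.

(** Since alpha^-2 + alpha^-1 = 1, Abel's relation is used on its boundary, where one argument is
    -1. Landen's formula at alpha^-2 removes the values at alpha^-2 and -alpha^-1 together. *)
Lemma Li2_inv_alpha3 : Li2 (/ alpha ^ 3) - Li2 (- / alpha ^ 3) = PI ^ 2 / 12 - 3 / 2 * ln alpha ^ 2.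
Proof.
  pose proof alpha_bounds as Hb; pose proof alpha_sqr as Hs; pose proof inv_alpha as Hi.
  assert (E2 : / alpha ^ 2 = 2 - alpha).
  { golden_field. }
  assert (E1 : 1 - / alpha ^ 2 = / alpha) by lra.
  pose proof (Li2_abel (/ alpha ^ 2) (- / alpha)) as H.
  rewrite Rabs_Ropp, (Rabs_pos_eq (/ alpha)) in H by lra.
  specialize (H ltac:(lra) ltac:(lra) ltac:(lra)).
  replace (1 - - / alpha) with alpha in H by lra.
  rewrite E1 in H.
  replace (/ alpha ^ 2 / alpha) with (/ alpha ^ 3) in H by (field; lra).
  replace (- / alpha / / alpha) with (-1) in H by (field; lra).
  replace (/ alpha ^ 2 * - / alpha / (/ alpha * alpha)) with (- / alpha ^ 3) in H by (field; lra).
  pose proof (Li2_landen (/ alpha ^ 2) ltac:(lra)) as HL.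
  rewrite E1 in HL.
  replace (/ alpha ^ 2 / / alpha) with (/ alpha) in HL by (field; lra).
  rewrite ln_inv_alpha in *; rewrite Li2_m1 in H; lra.
Qed.

(** Reflection leads from alpha/2 to 1/(2 alpha^2), and Landen's formula from there to -alpha^-3.
    Landen's formula also leads from -1/(2 alpha) to alpha^-3, so exactly the difference in
    [Li2_inv_alpha3] remains. *)
Lemma Li2_half_pair :
  Li2 (alpha / 2) + Li2 (- / (2 * alpha)) = PI ^ 2 / 12 + 2 * ln alpha ^ 2 - ln 2 ^ 2.
Proof.
  pose proof alpha_bounds as Hb; pose proof alpha_sqr as Hs; pose proof inv_alpha as Hi.
  pose proof (Li2_reflection (alpha / 2) ltac:(lra)) as H1; rewrite Li2_1 in H1.
  assert (E : 1 - alpha / 2 = / (2 * alpha ^ 2)) by golden_field.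
  pose proof (Li2_landen (/ (2 * alpha ^ 2)) ltac:(rewrite <- E; lra)) as H2.
  replace (1 - / (2 * alpha ^ 2)) with (alpha / 2) in H2 by (rewrite <- E; lra).
  replace (/ (2 * alpha ^ 2) / (alpha / 2)) with (/ alpha ^ 3) in H2 by (field; lra).
  assert (E3 : - / (2 * alpha) = (1 - alpha) / 2) by golden_field.
  pose proof (Li2_landen (- / (2 * alpha)) ltac:(rewrite E3; lra)) as H3.
  replace (1 - - / (2 * alpha)) with (alpha ^ 2 / 2) in H3 by (rewrite E3; simpl; lra).
  replace (- (- / (2 * alpha) / (alpha ^ 2 / 2))) with (/ alpha ^ 3) in H3 by (field; lra).
  rewrite E in H1.
  assert (Hl1 : ln (alpha / 2) = ln alpha - ln 2) by (apply ln_div; lra).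
  assert (Hl2 : ln (/ (2 * alpha ^ 2)) = - ln 2 - 2 * ln alpha).
  { rewrite ln_Rinv, ln_mult, ln_pow by nra; simpl; ring. }
  assert (Hl3 : ln (alpha ^ 2 / 2) = 2 * ln alpha - ln 2).
  { rewrite ln_div, ln_pow by nra; simpl; ring. }
  pose proof Li2_inv_alpha3 as H4.
  rewrite Hl1 in *; rewrite Hl2 in *; rewrite Hl3 in *; lra.
Qed.

Lemma Li2_fifth_pair :
  Li2 (alpha ^ 3 / 5) + Li2 (- / (5 * alpha ^ 3)) =
  PI ^ 2 / 12 + 2 * ln alpha ^ 2 - ln 2 ^ 2 - Li2 (- / 4)
    - (ln 2 - ln 5 - 2 * ln alpha) * (ln 2 - ln 5 + 2 * ln alpha).
Proof.
  pose proof alpha_bounds as Hb; pose proof alpha_sqr as Hs; pose proof inv_alpha as Hi.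
  (* Both arguments become linear in [alpha], so that the range conditions follow from its rational
     bounds. *)
  assert (E1 : alpha ^ 3 = 2 * alpha + 1) by golden_field.
  assert (E2 : / (5 * alpha ^ 3) = (2 * alpha - 3) / 5) by golden_field.
  pose proof (Li2_abel (alpha ^ 3 / 5) (- / (5 * alpha ^ 3))) as H.
  rewrite Rabs_Ropp, (Rabs_pos_eq (/ _)) in H by (rewrite E2; lra).
  specialize (H ltac:(rewrite E1; lra) ltac:(rewrite E2; lra) ltac:(rewrite E2, E1; lra)).
  (* The product of these two factors is 4/25, while the product of the arguments is -1/25; this is
     the origin of -1/4. *)
  assert (F1 : 1 - alpha ^ 3 / 5 = 2 / (5 * alpha ^ 2)) by golden_field.
  assert (F2 : 1 - - / (5 * alpha ^ 3) = 2 * alpha ^ 2 / 5) by golden_field.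
  rewrite F1, F2 in H.
  replace (alpha ^ 3 / 5 / (2 * alpha ^ 2 / 5)) with (alpha / 2) in H by (field; lra).
  replace (- / (5 * alpha ^ 3) / (2 / (5 * alpha ^ 2))) with (- / (2 * alpha)) in H by (field; lra).
  replace (alpha ^ 3 / 5 * - / (5 * alpha ^ 3) / (2 / (5 * alpha ^ 2) * (2 * alpha ^ 2 / 5)))
    with (- / 4) in H by (field; lra).
  replace (ln (2 / (5 * alpha ^ 2))) with (ln 2 - ln 5 - 2 * ln alpha) in H.
  2: { rewrite ln_div, ln_mult, ln_pow by nra; simpl; ring. }
  replace (ln (2 * alpha ^ 2 / 5)) with (ln 2 - ln 5 + 2 * ln alpha) in H.
  2: { rewrite ln_div, ln_mult, ln_pow by nra; simpl; ring. }
  pose proof Li2_half_pair; lra.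
Qed.

Lemma sqrt5_pos : 0 < sqrt 5.
Proof. apply sqrt_lt_R0; lra. Qed.

Lemma ln_sqrt5 : ln (sqrt 5) = / 2 * ln 5.
Proof.
  pose proof (ln_mult _ _ sqrt5_pos sqrt5_pos) as H; rewrite sqrt5_sqr in H; lra.
Qed.

Lemma one_sub_alpha_div_sqrt5 : 1 - alpha / sqrt 5 = / (sqrt 5 * alpha).
Proof. rewrite sqrt5_alpha; golden_field. Qed.

(** The arguments add up to 1, so reflection applies, and the product of logarithms is a difference
    of squares. *)
Lemma Li2_sqrt5_pair :
  Li2 (alpha / sqrt 5) + Li2 (/ (sqrt 5 * alpha)) = PI ^ 2 / 6 - / 4 * ln 5 ^ 2 + ln alpha ^ 2.
Proof.
  pose proof alpha_bounds as Hb; pose proof sqrt5_pos.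
  assert (0 < alpha / sqrt 5) by (apply Rdiv_lt_0_compat; lra).
  assert (0 < / (sqrt 5 * alpha)) by (apply Rinv_0_lt_compat; nra).
  pose proof one_sub_alpha_div_sqrt5 as E.
  pose proof (Li2_reflection (alpha / sqrt 5) ltac:(lra)) as Hr; rewrite E, Li2_1 in Hr.
  rewrite Hr, ln_div, ln_Rinv, ln_mult, ln_sqrt5 by nra; field.
Qed.

Lemma one_sub_alpha2_div4 : 1 - alpha ^ 2 / 4 = sqrt 5 / (4 * alpha).
Proof. rewrite sqrt5_alpha; golden_field. Qed.

Lemma one_sub_inv_4alpha2 : 1 - / (4 * alpha ^ 2) = sqrt 5 * alpha / 4.
Proof. rewrite sqrt5_alpha; golden_field. Qed.

(** In Abel's relation (1 - x)(1 - y) = 5/16 and xy = 1/16, which gives the argument 1/5; the other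
    two quotients form the pair of [Li2_sqrt5_pair]. *)
Lemma Li2_quarter_pair :
  Li2 (alpha ^ 2 / 4) + Li2 (/ (4 * alpha ^ 2)) =
  PI ^ 2 / 6 - / 4 * ln 5 ^ 2 + ln alpha ^ 2 - Li2 (/ 5)
    - (/ 2 * ln 5 - 2 * ln 2 - ln alpha) * (/ 2 * ln 5 - 2 * ln 2 + ln alpha).
Proof.
  pose proof alpha_bounds as Hb; pose proof alpha_sqr as Hs; pose proof inv_alpha as Hi.
  pose proof sqrt5_pos as H5.
  assert (E1 : alpha ^ 2 = alpha + 1) by golden_field.
  assert (E2 : / (4 * alpha ^ 2) = (2 - alpha) / 4) by golden_field.
  pose proof (Li2_abel (alpha ^ 2 / 4) (/ (4 * alpha ^ 2))) as H.
  rewrite (Rabs_pos_eq (/ _)) in H by (rewrite E2; lra).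
  specialize (H ltac:(rewrite E1; lra) ltac:(rewrite E2; lra) ltac:(rewrite E2, E1; lra)).
  rewrite one_sub_alpha2_div4, one_sub_inv_4alpha2 in H.
  replace (alpha ^ 2 / 4 / (sqrt 5 * alpha / 4)) with (alpha / sqrt 5) in H by (field; lra).
  replace (/ (4 * alpha ^ 2) / (sqrt 5 / (4 * alpha))) with (/ (sqrt 5 * alpha)) in H by (field; lra).
  replace (alpha ^ 2 / 4 * / (4 * alpha ^ 2) / (sqrt 5 / (4 * alpha) * (sqrt 5 * alpha / 4)))
    with (/ 5) in H by (rewrite <- sqrt5_sqr at 1; field; lra).
  assert (L4 : ln 4 = 2 * ln 2).
  { replace 4 with (2 * 2) by ring; rewrite ln_mult by lra; ring. }
  rewrite !ln_div, ln_mult, ln_mult, ln_sqrt5, L4 in H by nra.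
  pose proof Li2_sqrt5_pair; lra.
Qed.

(** * Sums over a pair of arguments *)

Definition kernel (z : R) (k : nat) : R :=
  z ^ k / ((2 * INR k - 1) * (2 * INR k) ^ 2 * (2 * INR k + 1)).

(** The sum enters through an equation, so that each closed form is left as an algebraic goal. *)
Lemma is_series_kernel_pair (x y s : R) : Rabs x < 1 -> Rabs y < 1 ->
  s = 1 - / 2 * (1 - x) * odd_series x - / 2 * (1 - y) * odd_series y - / 4 * (Li2 x + Li2 y) ->
  is_series (fun n => kernel x (S n) + kernel y (S n)) s.
Proof.
  intros Hx Hy ->.
  pose proof (is_series_plus _ _ _ _ (is_series_dilog_kernel x Hx) (is_series_dilog_kernel y Hy)) as H.
  evar_last; [exact H |]; unfold plus; simpl; field.
Qed.

Lemma odd_series_pos (x : R) : 0 < x < 1 -> odd_series x = arctanh (sqrt x) / sqrt x.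
Proof.
  intros Hx; assert (H := sqrt_lt_R0 x (proj1 Hx)).
  rewrite <- odd_series_arctanh, pow2_sqrt by
    (try lra; rewrite Rabs_pos_eq, <- sqrt_1 by lra; apply sqrt_lt_1; lra).
  field; lra.
Qed.

Lemma odd_series_neg (x : R) : 0 < x < 1 -> odd_series (- x) = atan (sqrt x) / sqrt x.
Proof.
  intros Hx; assert (H := sqrt_lt_R0 x (proj1 Hx)).
  rewrite <- odd_series_atan, pow2_sqrt by
    (try lra; rewrite Rabs_pos_eq, <- sqrt_1 by lra; apply sqrt_lt_1; lra).
  field; lra.
Qed.

(* Forces the equality of the terms to live in [R] rather than in [NormedModule.sort _ _], which [field] does not recognize. *)
Lemma is_series_ext_R (a b : nat -> R) (l : R) :
  (forall n, a n = b n) -> is_series a l -> is_series b l.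
Proof. exact (is_series_ext a b l). Qed.

Lemma kernel_denominators (n : nat) :
  0 < 2 * INR (S n) - 1 /\ 0 < INR (S n) /\ 0 < 2 * INR (S n) + 1.
Proof. rewrite S_INR; pose proof (pos_INR n); lra. Qed.

Lemma sqrt_alpha_pos : 0 < sqrt alpha.
Proof. apply sqrt_lt_R0; pose proof alpha_bounds; lra. Qed.

Lemma Luc_alpha (n : nat) : Luc n = alpha ^ n + (- / alpha) ^ n.
Proof. unfold Luc; now rewrite beta_alpha. Qed.

Lemma Rabs_lt1 (x : R) : -1 < x < 1 -> Rabs x < 1.
Proof. split_Rabs; lra. Qed.

(** * The five series *)

(** The pair is alpha/2 and beta/2 = -1/(2 alpha), with 2^(k+2) k^2 = 2^k (2k)^2. The positive
    argument yields arctanh, the negative one arctan. *)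
Lemma Lucas_series_half :
  is_series
    (fun n : nat => let k := S n in
       Luc k / (2 ^ (k + 2) * (2 * INR k - 1) * INR k ^ 2 * (2 * INR k + 1)))
    (1 - PI ^ 2 / 48 + / 4 * ln 2 ^ 2 - / 2 * ln alpha ^ 2
     - / (2 * alpha ^ 2 * sqrt (2 * alpha)) * arctanh (sqrt (alpha / 2))
     - alpha ^ 2 * sqrt alpha / (2 * sqrt 2) * atan (sqrt (/ (2 * alpha)))).
Proof.
  pose proof alpha_bounds as Hb; pose proof inv_alpha as Hi.
  assert (E : / (2 * alpha) = (alpha - 1) / 2) by (rewrite Rinv_mult, Hi; lra).
  assert (Hx : 1 - alpha / 2 = / (2 * alpha ^ 2)) by golden_field.
  assert (Hy : 1 - - / (2 * alpha) = alpha ^ 2 / 2) by golden_field.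
  apply is_series_ext_R with (fun n => kernel (alpha / 2) (S n) + kernel (- / (2 * alpha)) (S n)).
  - intros n; unfold kernel; cbv zeta; rewrite Luc_alpha.
    replace (- / (2 * alpha)) with (- / alpha / 2) by (field; lra).
    unfold Rdiv at 2 4; rewrite !Rpow_mult_distr, pow_inv, pow_add.
    pose proof (kernel_denominators n); pose proof (two_pow_pos (S n)); field; lra.
  - apply is_series_kernel_pair; [apply Rabs_lt1; rewrite ?E; lra.. |].
    rewrite Hx, Hy, odd_series_pos, odd_series_neg, Li2_half_pair by (rewrite ?E; lra).
    generalize (arctanh (sqrt (alpha / 2))) (atan (sqrt (/ (2 * alpha)))); intros u v.
    pose proof sqrt_alpha_pos; pose proof Rlt_sqrt2_0.
    rewrite sqrt_inv, sqrt_div, sqrt_mult by lra.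
    assert (H2 : sqrt 2 * sqrt 2 = 2) by (apply sqrt_sqrt; lra).
    field [H2]; lra.
Qed.

(** The pair is alpha^3/5 and beta^3/5 = -1/(5 alpha^3). *)
Lemma Lucas_series_fifth :
  is_series
    (fun n : nat => let k := S n in
       Luc (3 * k) / (5 ^ k * (2 * INR k - 1) * (2 * INR k) ^ 2 * (2 * INR k + 1)))
    (1 - PI ^ 2 / 48 + / 2 * ln 2 ^ 2 - 3 / 2 * ln alpha ^ 2 - / 2 * ln 2 * ln 5
     + / 4 * ln 5 ^ 2 + / 4 * Li2 (- / 4)
     - / (alpha ^ 3 * sqrt (5 * alpha)) * arctanh (alpha * sqrt alpha / sqrt 5)
     - alpha ^ 3 * sqrt alpha / sqrt 5 * atan (/ (alpha * sqrt (5 * alpha)))).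
Proof.
  pose proof alpha_bounds as Hb; pose proof sqrt5_pos as H5; pose proof sqrt_alpha_pos as Hp.
  assert (Hp2 : sqrt alpha * sqrt alpha = alpha) by (apply sqrt_sqrt; lra).
  assert (E1 : alpha ^ 3 = 2 * alpha + 1) by golden_field.
  assert (E2 : / (5 * alpha ^ 3) = (2 * alpha - 3) / 5) by golden_field.
  assert (Hx : 1 - alpha ^ 3 / 5 = 2 / (5 * alpha ^ 2)) by golden_field.
  assert (Hy : 1 - - / (5 * alpha ^ 3) = 2 * alpha ^ 2 / 5) by golden_field.
  apply is_series_ext_R with
    (fun n => kernel (alpha ^ 3 / 5) (S n) + kernel (- / (5 * alpha ^ 3)) (S n)).
  - intros n; unfold kernel; cbv zeta; rewrite Luc_alpha.
    replace (- / (5 * alpha ^ 3)) with ((- / alpha) ^ 3 / 5) by (field; lra).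
    unfold Rdiv at 2 4; rewrite !Rpow_mult_distr, <- !pow_mult, pow_inv.
    pose proof (kernel_denominators n); pose proof (pow_lt 5 (S n) ltac:(lra)); field; lra.
  - apply is_series_kernel_pair; [apply Rabs_lt1; rewrite ?E2, ?E1; lra.. |].
    rewrite odd_series_pos by (rewrite E1; lra).
    rewrite odd_series_neg by (rewrite E2; lra).
    replace (alpha * sqrt alpha / sqrt 5) with (sqrt (alpha ^ 3 / 5)).
    2: { rewrite sqrt_div by (rewrite ?E1; lra).
         replace (alpha ^ 3) with (alpha * alpha * alpha) by ring.
         rewrite sqrt_mult, sqrt_square by nra; reflexivity. }
    assert (Ey : sqrt (/ (5 * alpha ^ 3)) = / (alpha * sqrt (5 * alpha))).
    { rewrite sqrt_inv; f_equal; replace (5 * alpha ^ 3) with (alpha * alpha * (5 * alpha)) by ring.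
      rewrite sqrt_mult, sqrt_square by nra; reflexivity. }
    rewrite Ey, Hx, Hy, Li2_fifth_pair.
    replace (arctanh (sqrt (alpha ^ 3 / 5)) / sqrt (alpha ^ 3 / 5)) with
      (arctanh (sqrt (alpha ^ 3 / 5)) * sqrt 5 / (alpha * sqrt alpha)).
    2: { rewrite sqrt_div by (rewrite ?E1; lra).
         replace (alpha ^ 3) with (alpha * alpha * alpha) by ring.
         rewrite (sqrt_mult (alpha * alpha)), sqrt_square by nra; field; lra. }
    generalize (arctanh (sqrt (alpha ^ 3 / 5))) (atan (/ (alpha * sqrt (5 * alpha)))); intros u v.
    rewrite sqrt_mult by lra.
    pose proof sqrt5_sqr as H55.
    field [H55]; lra.
Qed.

Lemma alpha_beta_even_pow (r : nat) : Nat.Even r -> (- / alpha) ^ r = / alpha ^ r.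
Proof.
  intros [m ->]; rewrite <- pow_inv, !pow_mult; f_equal; ring.
Qed.

(** For even r, beta^r = alpha^-r, so x = alpha^r/L_r and y = beta^r/L_r are positive with sum 1,
    and reflection evaluates the dilogarithms. *)
Lemma Lucas_series_even (r : nat) : Nat.Even r ->
  is_series
    (fun n : nat => let k := S n in
       Luc (r * k) / (Luc r ^ k * (2 * INR k - 1) * (2 * INR k) ^ 2 * (2 * INR k + 1)))
    (1 - PI ^ 2 / 24 - / 4 * INR r ^ 2 * ln alpha ^ 2 + / 4 * ln (Luc r) ^ 2
     - / 2 * sqrt (/ (alpha ^ (3 * r) * Luc r)) * arctanh (sqrt (alpha ^ r / Luc r))
     - / 2 * sqrt (alpha ^ (3 * r) / Luc r) * arctanh (sqrt (/ (alpha ^ r * Luc r)))).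
Proof.
  intros Hr; pose proof alpha_bounds as Hb.
  assert (HA : 0 < alpha ^ r) by (apply pow_lt; lra).
  assert (Hlog : ln (alpha ^ r) = INR r * ln alpha) by (apply ln_pow; lra).
  assert (HL : Luc r = alpha ^ r + / alpha ^ r) by (now rewrite Luc_alpha, alpha_beta_even_pow).
  assert (HA' : 0 < / alpha ^ r) by now apply Rinv_0_lt_compat.
  assert (HLp : 0 < Luc r) by lra.
  set (x := alpha ^ r / Luc r); set (y := / (alpha ^ r * Luc r)).
  assert (Hx : 0 < x) by now apply Rdiv_lt_0_compat.
  assert (Hy : 0 < y) by (apply Rinv_0_lt_compat; nra).
  assert (Hxy : x + y = 1).
  { unfold x, y; rewrite HL; field; nra. }
  apply is_series_ext_R with (fun n => kernel x (S n) + kernel y (S n)).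
  - intros n; unfold kernel, x, y; cbv zeta.
    rewrite (Luc_alpha (r * S n)), !pow_mult, (alpha_beta_even_pow r Hr).
    rewrite Rinv_mult; unfold Rdiv at 2; rewrite !Rpow_mult_distr, !pow_inv.
    pose proof (kernel_denominators n).
    pose proof (pow_lt (Luc r) (S n) HLp); pose proof (pow_lt (alpha ^ r) (S n) HA).
    field; lra.
  - apply is_series_kernel_pair; [apply Rabs_lt1; lra.. |].
    rewrite !odd_series_pos by lra.
    pose proof (Li2_reflection x ltac:(lra)) as Hrefl.
    replace (1 - x) with y in * by lra; replace (1 - y) with x by lra.
    rewrite Hrefl, Li2_1.
    pose proof (sqrt_lt_R0 x Hx) as Hsx; pose proof (sqrt_lt_R0 y Hy) as Hsy.
    assert (Hx2 : sqrt x ^ 2 = x) by (apply pow2_sqrt; lra).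
    assert (Hy2 : sqrt y ^ 2 = y) by (apply pow2_sqrt; lra).
    (* The factor (1 - x)/sqrt x is y/sqrt x, whose square y^2/x equals 1/(alpha^(3r) L_r). *)
    replace (sqrt (/ (alpha ^ (3 * r) * Luc r))) with (y / sqrt x).
    2: { rewrite <- (sqrt_pow2 (y / sqrt x)) by (apply Rlt_le, Rdiv_lt_0_compat; lra).
         f_equal; unfold Rdiv; rewrite Rpow_mult_distr, pow_inv, Hx2, Nat.mul_comm, pow_mult.
         unfold x, y; field; lra. }
    replace (sqrt (alpha ^ (3 * r) / Luc r)) with (x / sqrt y).
    2: { rewrite <- (sqrt_pow2 (x / sqrt y)) by (apply Rlt_le, Rdiv_lt_0_compat; lra).
         f_equal; unfold Rdiv; rewrite Rpow_mult_distr, pow_inv, Hy2, Nat.mul_comm, pow_mult.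
         unfold x, y; field; lra. }
    assert (Hlx : ln x = INR r * ln alpha - ln (Luc r)).
    { unfold x; now rewrite ln_div, Hlog by lra. }
    assert (Hly : ln y = - (INR r * ln alpha) - ln (Luc r)).
    { unfold y; rewrite ln_Rinv, ln_mult, Hlog by nra; ring. }
    rewrite Hlx, Hly; field; lra.
Qed.

Lemma kernel_bound (z : R) (n : nat) : Rabs z < 1 -> Rabs (kernel z (S n)) <= Rabs z ^ S n.
Proof.
  intros Hz; unfold kernel, Rdiv.
  rewrite Rabs_mult, <- RPow_abs; rewrite <- (Rmult_1_r (Rabs z ^ S n)) at 2.
  apply Rmult_le_compat_l; [apply pow_le, Rabs_pos |].
  apply Rabs_inv_ge1; right.
  rewrite S_INR; pose proof (pos_INR n); nra.
Qed.

(** Geometric domination. It makes the even-indexed and the odd-indexed terms summable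
    separately. *)
Lemma ex_series_kernel_subseq (z : R) (i : nat) :
  Rabs z < 1 -> ex_series (fun n => kernel z (S (2 * n + i))).
Proof.
  intros Hz; pose proof (Rabs_pos z) as Hz0.
  assert (Hp : forall n, 0 <= Rabs z ^ n <= 1).
  { intros n; split; [now apply pow_le |].
    rewrite <- (pow1 n); apply pow_incr; lra. }
  apply (ex_series_le (K := R_AbsRing) (V := R_CompleteNormedModule) _ (fun n => (Rabs z ^ 2) ^ n)).
  - intros n; change (Rabs (kernel z (S (2 * n + i))) <= (Rabs z ^ 2) ^ n).
    eapply Rle_trans; [now apply kernel_bound |].
    replace (S (2 * n + i)) with (2 * n + S i)%nat by lia.
    rewrite pow_add, pow_mult; rewrite <- (Rmult_1_r ((Rabs z ^ 2) ^ n)) at 2.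
    apply Rmult_le_compat_l; [rewrite <- pow_mult |]; apply Hp.
  - eexists; apply is_series_geom; rewrite Rabs_pos_eq; simpl; nra.
Qed.

(** With x = alpha/sqrt 5 and y = -beta/sqrt 5, the numerator of x^k + y^k is alpha^k + (-beta)^k:
    this is L_k for even k and sqrt 5 F_k for odd k. The two series are thus the two halves of one
    series over the pair x, y. *)
Lemma Lucas_Fibonacci_series :
  ex_series
     (fun n : nat => let k := S n in
        Luc (2 * k) / (5 ^ k * (4 * INR k - 1) * (4 * INR k) ^ 2 * (4 * INR k + 1)))
   /\ ex_series
     (fun n : nat => let k := S n in
        Fib (2 * k - 1) / (5 ^ (k - 1) * (4 * INR k - 3) * (4 * INR k - 2) ^ 2 * (4 * INR k - 1)))
   /\ Series
        (fun n : nat => let k := S n in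
           Luc (2 * k) / (5 ^ k * (4 * INR k - 1) * (4 * INR k) ^ 2 * (4 * INR k + 1)))
      + Series
        (fun n : nat => let k := S n in
           Fib (2 * k - 1) / (5 ^ (k - 1) * (4 * INR k - 3) * (4 * INR k - 2) ^ 2 * (4 * INR k - 1)))
      = 1 - PI ^ 2 / 24 + / 16 * ln 5 ^ 2 - / 4 * ln alpha ^ 2
        - / (2 * sqrt (sqrt 5))
          * (/ (alpha * sqrt alpha) * arctanh (sqrt (alpha / sqrt 5))
             + alpha * sqrt alpha * arctanh (sqrt (/ (sqrt 5 * alpha)))).
Proof.
  pose proof alpha_bounds as Hb; pose proof sqrt5_pos as H5; pose proof sqrt_alpha_pos as Hp.
  pose proof sqrt5_sqr as H55.
  set (x := alpha / sqrt 5); set (y := / (sqrt 5 * alpha)).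
  assert (Hx0 : 0 < x) by (apply Rdiv_lt_0_compat; lra).
  assert (Hy0 : 0 < y) by (apply Rinv_0_lt_compat; nra).
  assert (Hxy : 1 - x = y) by apply one_sub_alpha_div_sqrt5.
  assert (Hx : Rabs x < 1) by (apply Rabs_lt1; lra).
  assert (Hy : Rabs y < 1) by (apply Rabs_lt1; lra).
  set (fL := fun n : nat => _); set (fF := fun n : nat => let k := S n in Fib _ / _).
  pose (u := fun n => kernel x (S n) + kernel y (S n)).
  assert (Hy' : y = - (- / alpha) / sqrt 5) by (unfold y; field; lra).
  (* [u] at 2n has the exponent 2n + 1 = 2k - 1, so the even indices give the Fibonacci terms. *)
  assert (EF : forall n, u (2 * n)%nat = fF n).
  { intros n; unfold u, fF, kernel, Fib; cbv zeta.
    replace (2 * S n - 1)%nat with (S (2 * n)) by lia.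
    replace (S n - 1)%nat with n by lia.
    rewrite Hy', beta_alpha; unfold x, Rdiv at 2 4; rewrite !Rpow_mult_distr, pow_inv.
    replace ((- - / alpha) ^ S (2 * n)) with (- (- / alpha) ^ S (2 * n)).
    2: { rewrite <- !tech_pow_Rmult, !pow_mult; replace ((- - / alpha) ^ 2) with ((- / alpha) ^ 2) by ring; ring. }
    replace (sqrt 5 ^ S (2 * n)) with (sqrt 5 * 5 ^ n).
    2: { rewrite <- tech_pow_Rmult, pow_mult; do 2 f_equal; simpl; lra. }
    replace (alpha - - / alpha) with (sqrt 5).
    2: { rewrite inv_alpha, sqrt5_alpha; ring. }
    rewrite !S_INR, mult_INR; simpl (INR 2).
    pose proof (pos_INR n); pose proof (pow_lt 5 n ltac:(lra)); field; repeat split; lra. }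
  assert (EL : forall n, u (2 * n + 1)%nat = fL n).
  { intros n; unfold u, fL, kernel; cbv zeta.
    rewrite Luc_alpha; replace (S (2 * n + 1)) with (2 * S n)%nat by lia.
    rewrite Hy'; unfold x, Rdiv at 2 4; rewrite !Rpow_mult_distr, pow_inv, !pow_mult.
    replace ((- - / alpha) ^ 2) with ((- / alpha) ^ 2) by ring.
    replace (sqrt 5 ^ 2) with 5 by (simpl; lra).
    rewrite mult_INR; simpl (INR 2).
    pose proof (kernel_denominators n); pose proof (pow_lt 5 (S n) ltac:(lra)).
    field; repeat split; lra. }
  assert (Hsub : forall i, ex_series (fun n => u (2 * n + i)%nat)).
  { intros i; apply (ex_series_plus (fun n => kernel x (S (2 * n + i))) (fun n => kernel y (S (2 * n + i))));
      now apply ex_series_kernel_subseq. }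
  assert (HexF : ex_series fF).
  { apply ex_series_ext with (2 := Hsub 0%nat); intros n; rewrite Nat.add_0_r; apply EF. }
  assert (HexL : ex_series fL).
  { apply ex_series_ext with (2 := Hsub 1%nat); exact EL. }
  split; [exact HexL | split; [exact HexF |]].
  (* [is_series_even_odd] takes the even indices, here the Fibonacci part, first. *)
  rewrite Rplus_comm.
  transitivity (Series u).
  - symmetry; apply is_series_unique, is_series_even_odd.
    + apply is_series_ext_R with fF; [intros n; now rewrite EF | now apply Series_correct].
    + apply is_series_ext_R with fL; [intros n; now rewrite EL | now apply Series_correct].
  - apply is_series_unique, is_series_kernel_pair; auto.
    replace (1 - y) with x by lra; rewrite Hxy, !odd_series_pos by lra.
    unfold x, y; rewrite Li2_sqrt5_pair.
    generalize (arctanh (sqrt (alpha / sqrt 5))) (arctanh (sqrt (/ (sqrt 5 * alpha)))); intros v w.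
    assert (Hq : 0 < sqrt (sqrt 5)) by now apply sqrt_lt_R0.
    rewrite sqrt_inv, sqrt_mult, sqrt_div by lra.
    assert (Hq2 : sqrt 5 = sqrt (sqrt 5) * sqrt (sqrt 5)) by (rewrite sqrt_sqrt; lra).
    assert (Hp2 : alpha = sqrt alpha * sqrt alpha) by (rewrite sqrt_sqrt; lra).
    revert Hq Hp Hq2 Hp2; generalize (sqrt alpha) (sqrt (sqrt 5)); intros p q Hq Hp Hq2 Hp2.
    (* Naming the logarithm first protects it when [alpha] is replaced by p * p. *)
    rewrite Hq2; set (la := ln alpha); rewrite Hp2; field; lra.
Qed.

(** The arguments alpha^2/4 and beta^2/4 are squares, so both arctanh values are logarithms of sqrt
    5 and [alpha], and no arctanh survives in the sum. *)
Lemma Lucas_series_quarter :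
  is_series
    (fun n : nat => let k := S n in
       Luc (2 * k) / (4 ^ (k + 1) * (2 * INR k - 1) * INR k ^ 2 * (2 * INR k + 1)))
    (1 - PI ^ 2 / 24 - / 2 * ln alpha ^ 2 - 9 * sqrt 5 / 8 * ln alpha + 5 / 16 * ln 5
     + / 8 * ln 5 ^ 2 - / 2 * ln 2 * ln 5 + ln 2 ^ 2 + / 4 * Li2 (/ 5)).
Proof.
  pose proof alpha_bounds as Hb; pose proof sqrt5_pos as H5.
  assert (E1 : alpha ^ 2 = alpha + 1) by golden_field.
  assert (E2 : / (4 * alpha ^ 2) = (2 - alpha) / 4) by golden_field.
  apply is_series_ext_R with
    (fun n => kernel (alpha ^ 2 / 4) (S n) + kernel (/ (4 * alpha ^ 2)) (S n)).
  - intros n; unfold kernel; cbv zeta; rewrite Luc_alpha.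
    replace (/ (4 * alpha ^ 2)) with ((- / alpha) ^ 2 / 4) by (field; lra).
    unfold Rdiv at 2 4; rewrite !Rpow_mult_distr, <- !pow_mult, pow_inv, pow_add.
    pose proof (kernel_denominators n); pose proof (pow_lt 4 (S n) ltac:(lra)); field; lra.
  - apply is_series_kernel_pair; [apply Rabs_lt1; rewrite ?E2, ?E1; lra.. |].
    rewrite one_sub_alpha2_div4, one_sub_inv_4alpha2, Li2_quarter_pair.
    replace (odd_series (alpha ^ 2 / 4)) with ((/ 2 * ln 5 + 3 * ln alpha) / alpha).
    2: { replace (alpha ^ 2 / 4) with ((alpha / 2) ^ 2) by field.
         apply Rmult_eq_reg_l with (alpha / 2); [| lra].
         rewrite odd_series_arctanh by (apply Rabs_lt1; lra); unfold arctanh.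
         replace ((1 + alpha / 2) / (1 - alpha / 2)) with (sqrt 5 * alpha ^ 3)
           by (rewrite sqrt5_alpha; golden_field).
         rewrite ln_mult, ln_pow, ln_sqrt5 by (try apply pow_lt; lra).
         simpl (INR 3); field; lra. }
    replace (odd_series (/ (4 * alpha ^ 2))) with (alpha * (3 * ln alpha - / 2 * ln 5)).
    2: { replace (/ (4 * alpha ^ 2)) with ((/ (2 * alpha)) ^ 2) by (field; lra).
         assert (E3 : / (2 * alpha) = (alpha - 1) / 2) by golden_field.
         apply Rmult_eq_reg_l with (/ (2 * alpha)); [| rewrite E3; lra].
         rewrite odd_series_arctanh by (apply Rabs_lt1; rewrite E3; lra); unfold arctanh.
         replace ((1 + / (2 * alpha)) / (1 - / (2 * alpha))) with (alpha ^ 3 / sqrt 5).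
         2: { rewrite sqrt5_alpha, E3; golden_field. }
         rewrite ln_div, ln_pow, ln_sqrt5 by (try apply pow_lt; lra).
         simpl (INR 3); field; lra. }
    assert (E4 : / alpha ^ 2 = 2 - alpha) by golden_field.
    replace (/ 2 * (sqrt 5 / (4 * alpha)) * ((/ 2 * ln 5 + 3 * ln alpha) / alpha)) with
      (/ 8 * sqrt 5 * / alpha ^ 2 * (/ 2 * ln 5 + 3 * ln alpha)) by (field; lra).
    replace (/ 2 * (sqrt 5 * alpha / 4) * (alpha * (3 * ln alpha - / 2 * ln 5))) with
      (/ 8 * sqrt 5 * alpha ^ 2 * (3 * ln alpha - / 2 * ln 5)) by field.
    rewrite E4, E1.
    pose proof sqrt5_sqr as H55.
    (* Once its logarithm is abstracted, [alpha] can be expanded, which leaves an identity in sqrt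
       5. *)
    generalize (ln alpha); intros la; unfold alpha; field [H55].
Qed.

(* Every series is indexed by n : nat with k = S n, i.e. k ranges over 1, 2, 3, ... *)
Theorem theorem15 :
  is_series
    (fun n : nat => let k := S n in
       Luc k / (2 ^ (k + 2) * (2 * INR k - 1) * INR k ^ 2 * (2 * INR k + 1)))
    (1 - PI ^ 2 / 48 + / 4 * ln 2 ^ 2 - / 2 * ln alpha ^ 2
     - / (2 * alpha ^ 2 * sqrt (2 * alpha)) * arctanh (sqrt (alpha / 2))
     - alpha ^ 2 * sqrt alpha / (2 * sqrt 2) * atan (sqrt (/ (2 * alpha))))
  /\
  is_series
    (fun n : nat => let k := S n in
       Luc (3 * k) / (5 ^ k * (2 * INR k - 1) * (2 * INR k) ^ 2 * (2 * INR k + 1)))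
    (1 - PI ^ 2 / 48 + / 2 * ln 2 ^ 2 - 3 / 2 * ln alpha ^ 2 - / 2 * ln 2 * ln 5
     + / 4 * ln 5 ^ 2 + / 4 * Li2 (- / 4)
     - / (alpha ^ 3 * sqrt (5 * alpha)) * arctanh (alpha * sqrt alpha / sqrt 5)
     - alpha ^ 3 * sqrt alpha / sqrt 5 * atan (/ (alpha * sqrt (5 * alpha))))
  /\
  (forall r : nat, Nat.Even r ->
    is_series
      (fun n : nat => let k := S n in
         Luc (r * k) / (Luc r ^ k * (2 * INR k - 1) * (2 * INR k) ^ 2 * (2 * INR k + 1)))
      (1 - PI ^ 2 / 24 - / 4 * INR r ^ 2 * ln alpha ^ 2 + / 4 * ln (Luc r) ^ 2
       - / 2 * sqrt (/ (alpha ^ (3 * r) * Luc r)) * arctanh (sqrt (alpha ^ r / Luc r))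
       - / 2 * sqrt (alpha ^ (3 * r) / Luc r) * arctanh (sqrt (/ (alpha ^ r * Luc r)))))
  /\
  (ex_series
     (fun n : nat => let k := S n in
        Luc (2 * k) / (5 ^ k * (4 * INR k - 1) * (4 * INR k) ^ 2 * (4 * INR k + 1)))
   /\ ex_series
     (fun n : nat => let k := S n in
        Fib (2 * k - 1) / (5 ^ (k - 1) * (4 * INR k - 3) * (4 * INR k - 2) ^ 2 * (4 * INR k - 1)))
   /\ Series
        (fun n : nat => let k := S n in
           Luc (2 * k) / (5 ^ k * (4 * INR k - 1) * (4 * INR k) ^ 2 * (4 * INR k + 1)))
      + Series
        (fun n : nat => let k := S n in
           Fib (2 * k - 1) / (5 ^ (k - 1) * (4 * INR k - 3) * (4 * INR k - 2) ^ 2 * (4 * INR k - 1)))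
      = 1 - PI ^ 2 / 24 + / 16 * ln 5 ^ 2 - / 4 * ln alpha ^ 2
        - / (2 * sqrt (sqrt 5))
          * (/ (alpha * sqrt alpha) * arctanh (sqrt (alpha / sqrt 5))
             + alpha * sqrt alpha * arctanh (sqrt (/ (sqrt 5 * alpha)))))
  /\
  is_series
    (fun n : nat => let k := S n in
       Luc (2 * k) / (4 ^ (k + 1) * (2 * INR k - 1) * INR k ^ 2 * (2 * INR k + 1)))
    (1 - PI ^ 2 / 24 - / 2 * ln alpha ^ 2 - 9 * sqrt 5 / 8 * ln alpha + 5 / 16 * ln 5
     + / 8 * ln 5 ^ 2 - / 2 * ln 2 * ln 5 + ln 2 ^ 2 + / 4 * Li2 (/ 5)).
Proof.
  split; [exact Lucas_series_half |].
  split; [exact Lucas_series_fifth |].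
  split; [exact Lucas_series_even |].
  split; [exact Lucas_Fibonacci_series | exact Lucas_series_quarter].
Qed.
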